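(* Let $A\in\mathscr R$ be a fixed set and let $\mathbf X^{(1)},\mathbf X^{(2)},\ldots$ be a sequence of random vectors in $[0,\infty)^d$ with common distribution $F$. Let $N$ be a non-negative, discrete (integer-valued) random variable, not degenerate at zero, independent of $\{\mathbf X^{(1)},\mathbf X^{(2)},\ldots\}$, and put $\mathbf S_N=\sum_{i=1}^N\mathbf X^{(i)}$ (with $\mathbf S_0=\mathbf 0$). (i) If $\mathbf X^{(1)},\mathbf X^{(2)},\ldots$ are $TAI_A$, $F\in(\mathcal D\cap\mathcal L)_A$, and $\mathbf E[N^{p+1}]<\infty$ for some $p>J^+_{F_A}$, then $$\mathbf P[\mathbf S_N\in xA]\sim\mathbf E[N]\,F(xA),\qquad x\to\infty,$$ and the distribution of $\mathbf S_N$ belongs to $(\mathcal D\cap\mathcal L)_A$. (ii) If $\mathbf X^{(1)},\mathbf X^{(2)},\ldots$ are $QAI_A$, $F\in\mathcal C_A$, and $\mathbf E[N^{p+1}]<\infty$ for some $p>J^+_{F_A}$, then $$\mathbf P[\mathbf S_N\in xA]\sim\mathbf E[N]\,F(xA),\qquad x\to\infty,$$ and the distribution of $\mathbf S_N$ belongs to $\mathcal C_A$. (iii) If $\mathbf X^{(1)},\mathbf X^{(2)},\ldots$ are $QAI_A$, $F\in MRV(\alpha,V,\mu)$ with $\alpha\in(0,\infty)$, and $\mathbf E[N^{p+1}]<\infty$ for some $p>J^+_{F_A}$, then $$\mathbf P[\mathbf S_N\in xA]\sim\mathbf E[N]\,\mu(A)\,\overline V(x),\qquad x\to\infty.$$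
   Context: Fix an integer $d\ge 1$. $\mathscr R$ is the family of nonempty sets $A\subsetneq\mathbb R^d$ that are open, increasing (if $\mathbf x\in A$ and $\mathbf a\in[0,\infty)^d$ then $\mathbf x+\mathbf a\in A$), have convex complement $A^c$, and satisfy $\mathbf 0\notin\overline A$ (closure). For a random vector $\mathbf X$ in $[0,\infty)^d$ with distribution $F$ write $F(xA):=\mathbf P[\mathbf X\in xA]$, put $Y_A:=\sup\{u>0:\mathbf X\in uA\}$ (with $\sup\emptyset=0$), and let $F_A$ be the distribution of $Y_A$; its tail is $\overline F_A(x)=\mathbf P[Y_A>x]=\mathbf P[\mathbf X\in xA]$ for $x>0$. Write $Y_A^{(i)}:=\sup\{u>0:\mathbf X^{(i)}\in uA\}$. For a distribution $V$ on $[0,\infty)$ write $\overline V=1-V$ and assume $\overline V(x)>0$ for all $x\ge0$. $V\in\mathcal C$ if $\lim_{b\uparrow1}\limsup_{x\to\infty}\overline V(bx)/\overline V(x)=1$. $V\in\mathcal D$ if $\limsup_{x\to\infty}\overline V(bx)/\overline V(x)<\infty$ for every (equivalently, some) $b\in(0,1)$. $V\in\mathcal L$ if $\lim_{x\to\infty}\overline V(x-y)/\overline V(x)=1$ for every (equivalently, some) $y>0$. $V\in\mathcal R_{-\alpha}$ if $\lim_{x\to\infty}\overline V(tx)/\overline V(x)=t^{-\alpha}$ for every $t>0$. For $\mathcal B\in\{\mathcal C,\mathcal D\cap\mathcal L\}$, $F\in\mathcal B_A$ means $F_A\in\mathcal B$. The upper Matuszewska index is $J_V^+:=-\lim_{v\to\infty}\frac{\log\overline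 V_*(v)}{\log v}$ with $\overline V_*(v):=\liminf_{x\to\infty}\overline V(vx)/\overline V(x)$. Dependence notions for the sequence: - $TAI_A$ (tail asymptotically independent on $A$): $\lim_{x_i\wedge x_j\to\infty}\mathbf P[Y_A^{(i)}>x_i\mid Y_A^{(j)}>x_j]=0$ for all $i\ne j$. - $QAI_A$ (quasi asymptotically independent on $A$): $\lim_{x\to\infty}\dfrac{\mathbf P[Y_A^{(i)}>x,\,Y_A^{(j)}>x]}{\mathbf P[Y_A^{(i)}>x]+\mathbf P[Y_A^{(j)}>x]}=0$ for all $i\ne j$. Standard multivariate regular variation: the distribution $F$ of $\mathbf X$ belongs to $MRV(\alpha,V,\mu)$, where $V\in\mathcal R_{-\alpha}$ and $\mu$ is a Radon measure on $[0,\infty]^d\setminus\{\mathbf 0\}$ not identically zero, if $\lim_{x\to\infty}\mathbf P[\mathbf X\in x\mathbb B]/\overline V(x)=\mu(\mathbb B)$ for every Borel set $\mathbb B\subseteq[0,\infty]^d$ with $\mathbf 0\notin\overline{\mathbb B}$ and $\mu(\partial\mathbb B)=0$. For $A\in\mathscr R$, $\mu(A)$ means $\mu(A\cap[0,\infty)^d)$. $f\sim g$ means $f(x)/g(x)\to1$ as $x\to\infty$.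
   Formalization: In (iii), the relation P[S_N∈xA] ~ E[N]μ(A)V̄(x) is asserted only when μ(A)≠0, since for μ(A)=0 the right side vanishes and the quotient is undefined; in all cases the limit P[S_N∈xA]/V̄(x) → E[N]μ(A) is asserted as well. *)

(* Defs.v *)
From HB Require Import structures.
From mathcomp Require Import all_boot all_order all_algebra.
From mathcomp Require Import all_classical all_reals all_analysis.

Set Implicit Arguments.
Unset Strict Implicit.
Unset Printing Implicit Defensive.

Import Order.TTheory GRing.Theory Num.Theory.
Import numFieldNormedType.Exports.

Local Open Scope classical_set_scope.
Local Open Scope ring_scope.

(* Row vectors carry no measurable structure in the library: ['rV[T]_d] with the
   sigma-algebra generated by its open sets. *)
Notation borel_rV T d := (g_sigma_algebraType (@open 'rV[T]_d)).

Section SetFamily.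
Context {R : realType} {d : nat}.
Implicit Types (A : set 'rV[R]_d) (x y : 'rV[R]_d) (u : R).

Definition nonneg_vec x : Prop := forall j, 0 <= x ord0 j.

Definition dilate u A : set 'rV[R]_d := [set u *: x | x in A].

Definition family_R A : Prop :=
  [/\ A !=set0 /\ A != setT,
      open A,
      forall x a, A x -> nonneg_vec a -> A (x + a),
      convex_set (~` A) &
      ~ closure A 0].

(* The map [y |-> sup {u > 0 : y in u A}], so that Y_A = gauge A (X);
   the library has [sup set0 = 0]. *)
Definition gauge A y : R := sup [set u | 0 < u /\ dilate u A y].

(* The distribution F_A of Y_A when the random vector has distribution F. *)
Definition dist_on A (F : set (borel_rV R d) -> \bar R) : set R -> \bar R :=
  pushforward F (gauge A : borel_rV R d -> R).

End SetFamily.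

Section TailClasses.
Context {R : realType}.
Implicit Types (V : set R -> \bar R) (b v x y t : R).

Definition tail V x : R := fine (V `]x, +oo[%classic).

Definition tail_pos V : Prop := forall x, 0 <= x -> 0 < tail V x.

Definition limsup_ratio V b : \bar R :=
  limf_esup (fun x => (tail V (b * x) / tail V x)%:E) +oo_R.

Definition liminf_ratio V v : \bar R :=
  limf_einf (fun x => (tail V (v * x) / tail V x)%:E) +oo_R.

Definition class_C V : Prop :=
  tail_pos V /\ limsup_ratio V b @[b --> 1^'-] --> 1%E.

Definition class_D V : Prop :=
  tail_pos V /\ forall b, 0 < b < 1 -> (limsup_ratio V b < +oo)%E.

Definition class_L V : Prop :=
  tail_pos V /\
  forall y, 0 < y -> tail V (x - y) / tail V x @[x --> +oo_R] --> (1 : R).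

Definition class_DL V : Prop := class_D V /\ class_L V.

Definition class_RV (alpha : R) V : Prop :=
  tail_pos V /\
  forall t, 0 < t -> tail V (t * x) / tail V x @[x --> +oo_R] --> t `^ (- alpha).

(* Extended-real valued, with [lne 0 = -oo]: the index is [+oo] when
   [liminf_ratio V v] vanishes for all large [v]. *)
Definition upper_Matuszewska V : \bar R :=
  (- lim (lne (liminf_ratio V v) / (ln v)%:E @[v --> +oo_R]))%E.

Definition asymp_equiv (f g : R -> R) : Prop :=
  f x / g x @[x --> +oo_R] --> (1 : R).

End TailClasses.

Section Dependence.
Context {R : realType} {dO : measure_display} {Omega : measurableType dO}.
Context {d : nat}.
Variable P : probability Omega R.
Implicit Types (X : nat -> {RV P >-> borel_rV R d}) (N : {RV P >-> nat}).
Implicit Types (A : set 'rV[R]_d) (E H : set Omega).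

Definition prob E : R := fine (P E).

Definition cond_prob E H : R := prob (E `&` H) / prob H.

(* The event Y_A^{(i)} > x. *)
Definition exceeds A X (i : nat) (x : R) : set Omega :=
  [set w | x < gauge A (X i w)].

(* The filter of [min(x_i, x_j) -> +oo] is the product filter. *)
Definition TAI A X : Prop := forall i j : nat, i != j ->
  cond_prob (exceeds A X i z.1) (exceeds A X j z.2)
    @[z --> filter_prod +oo_R +oo_R] --> (0 : R).

Definition QAI A X : Prop := forall i j : nat, i != j ->
  prob (exceeds A X i x `&` exceeds A X j x) /
    (prob (exceeds A X i x) + prob (exceeds A X j x))
    @[x --> +oo_R] --> (0 : R).

Definition common_distribution X (F : probability (borel_rV R d) R) : Prop :=
  forall i (B : set (borel_rV R d)), measurable B -> distribution P (X i) B = F B.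

(* The sigma-algebra generated by the whole sequence. *)
Definition sigma_seq X : set (set Omega) :=
  <<s [set E | exists i (B : set (borel_rV R d)),
               measurable B /\ E = X i @^-1` B] >>.

Definition indep_seq N X : Prop := forall E (K : set nat), sigma_seq X E ->
  P (N @^-1` K `&` E) = (P (N @^-1` K) * P E)%E.

(* Sequences are indexed from 0: [X i] is the (i+1)-st vector of the sequence. *)
Definition random_sum X N (w : Omega) : borel_rV R d :=
  (\sum_(i < N w) (X i w : 'rV[R]_d) : 'rV[R]_d).

End Dependence.

Section RegularVariation.
Context {R : realType} {d : nat}.
Implicit Types (B : set 'rV[\bar R]_d).

(* [0, +oo]^d is realised inside ['rV[\bar R]_d]; it is closed there. *)
Definition ext_orthant : set 'rV[\bar R]_d :=
  [set z | forall j, (0 <= z ord0 j)%E].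

Definition ext_zero : 'rV[\bar R]_d := const_mx 0%E.

Definition punctured_orthant : set 'rV[\bar R]_d := ext_orthant `\ ext_zero.

Definition embed (x : 'rV[R]_d) : 'rV[\bar R]_d := map_mx EFin x.

Definition ext_dilate (u : R) B : set 'rV[\bar R]_d :=
  [set map_mx (fun t => (u%:E * t)%E) z | z in B].

(* Boundary of a subset of [0, +oo]^d relative to [0, +oo]^d, not to the
   ambient ['rV[\bar R]_d]. For [B] bounded away from 0 it is also the boundary
   relative to [0, +oo]^d minus the origin. *)
Definition rel_boundary B : set 'rV[\bar R]_d :=
  closure B `&` closure (ext_orthant `\` B).

(* A measure on [0, +oo]^d minus the origin is seen as a measure on
   ['rV[\bar R]_d] vanishing elsewhere. The punctured orthant is locally compact
   with a countable base, so a Borel measure on it is Radon as soon as it is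
   finite on compact sets. *)
Definition radon_punctured (mu : {measure set (borel_rV (\bar R) d) -> \bar R}) :
    Prop :=
  mu (~` punctured_orthant) = 0%E /\
  forall K : set 'rV[\bar R]_d, K `<=` punctured_orthant -> compact K ->
    (mu K < +oo)%E.

(* [V] is carried by [0, +oo[. *)
Definition on_nonneg (V : probability R R) : Prop := V `]-oo, 0[%classic = 0%E.

Definition MRV (F : probability (borel_rV R d) R) (alpha : R)
    (V : probability R R)
    (mu : {measure set (borel_rV (\bar R) d) -> \bar R}) : Prop :=
  [/\ on_nonneg V,
      class_RV alpha V,
      radon_punctured mu,
      mu punctured_orthant <> 0%E &
      forall B, measurable (B : set (borel_rV (\bar R) d)) ->
        B `<=` ext_orthant -> ~ closure B ext_zero ->
        mu (rel_boundary B) = 0%E ->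
        (fine (F (embed @^-1` ext_dilate x B)) / tail V x)%:E
          @[x --> +oo_R] --> mu B].

(* mu(A) is the mass of the part of A in [0, +oo[^d. *)
Definition limit_mass (mu : {measure set (borel_rV (\bar R) d) -> \bar R})
    (A : set 'rV[R]_d) : R :=
  fine (mu (embed @` (A `&` nonneg_vec))).

End RegularVariation.

(* Main.v *)
Require Import Defs.
From mathcomp Require Import all_boot all_order all_algebra.
From mathcomp Require Import all_classical all_reals all_analysis.
From mathcomp Require Import measurable_realfun ring lra.

Set Implicit Arguments.
Unset Strict Implicit.
Unset Printing Implicit Defensive.

Import Order.TTheory GRing.Theory Num.Theory.
Import numFieldNormedType.Exports.

Local Open Scope classical_set_scope.
Local Open Scope ring_scope.

(** The gauge of [A] is the Minkowski functional of the convex complement of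
    [A], so it is subadditive ([gauge_addv_le]), and it is nondecreasing along
    nonnegative directions because [A] is increasing ([gauge_addv_ge]).  With
    [Y_i] the gauge of the [i]-th vector and [T_n] the gauge of the sum of the
    first [n], this gives [max_(i < n) Y_i <= T_n <= \sum_(i < n) Y_i], and for
    [x > 0] the sum lies in [x A] exactly when [T_n > x].  The claim is thus
    one about real random variables with common tail [G].

    For a fixed number [n] of terms, [P (T_n > x)] is asymptotic to [n * G x].
    The lower bound is Bonferroni's inequality ([tail_sum_ge_pairs]).  The upper
    bound is the principle of a single big jump ([tail_sum_le_pairs]): either
    one term exceeds [x - a], or two different terms exceed [x / n] and [a / n].
    In the class C one takes [a] a small multiple of [x], and both terms exceed
    a common level, which quasi asymptotic independence controls
    ([tail_sum_ratio_rescale]).  In the class of long tails [a] may be a large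
    constant, but the two levels are then very different, which is why tail
    asymptotic independence enters ([tail_sum_ratio_shift]).

    To pass to a random number of terms, [P (T_n > x) / G x] is dominated by
    [C * n ^ (p + 1)]: some term exceeds [x / n], and an index below
    [p] yields [G (x / n) <= C * n ^ p * G x] ([Matuszewska_power_bound], where
    Fekete's argument shows that the limit defining the index exists).  The
    number of terms being independent of the vectors, dominated convergence on
    it gives the limit [E N] ([random_index_ratio]).  The classes are stable
    under tail equivalence.

    Under multivariate regular variation, [G x / V x] tends to the limit measure
    of [A] ([MRV_tail_gauge]).  Scaling makes the measure of the superlevel sets
    of the gauge a multiple of [t ^ (- alpha)] off the countably many levels [t]
    that it charges, and by monotonicity at all levels; likewise the points with an
    infinite coordinate are negligible.  If the limit measure of [A] is
    positive, [G] is regularly varying and the argument for the class C applies.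
    If it is zero, the dominating bound alone shows that the probability is
    negligible ([random_sum_negligible]). *)

(** * The gauge of a set of the family *)

Lemma measurable_closed_rV (T : ptopologicalType) (n : nat) (C : set 'rV[T]_n) :
  closed C -> measurable (C : set (borel_rV T n)).
Proof.
move=> cC; rewrite -(setCK C); apply: measurableC; apply: sub_sigma_algebra.
exact: closed_openC.
Qed.

Lemma closed_nonneg_vec (R : realType) (d : nat) : closed (@nonneg_vec R d).
Proof.
rewrite (_ : nonneg_vec = \bigcap_(j : 'I_d) [set z : 'rV[R]_d | 0 <= z ord0 j]).
  apply: closed_bigI => j _.
  apply: (@closed_comp _ _ (fun z : 'rV[R]_d => z ord0 j) [set x | 0 <= x]).
    by move=> z _; exact: coord_continuous.
  exact: closed_ge.
by apply/seteqP; split => [z zo j _|z zo j]; [exact: zo|exact: (zo j I)].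
Qed.

Section Gauge.
Context {R : realType} {d : nat} (A : set 'rV[R]_d) (hA : family_R A).
Implicit Types (x y z : 'rV[R]_d).

Lemma family_R_conv x y (l : R) : 0 <= l -> l <= 1 ->
  ~ A x -> ~ A y -> ~ A (l *: x + (1 - l) *: y).
Proof.
move=> l0 l1 nx ny; case: hA => _ _ _ cA _.
have i01 : Itv.spec (@Itv.num_sem R) (Itv.Real `[0%Z, 1%Z]%R) l.
  by rewrite /Itv.spec/= /Itv.num_sem num_real in_itv/= l0 l1.
have /= := cA x y (Itv.mk i01).
by rewrite !in_setE => /(_ nx ny).
Qed.

Lemma family_R_away0 : exists2 r : R, 0 < r & forall y, A y -> r <= `|y|.
Proof.
case: hA => _ _ _ _ /existsNP[B] /not_implyP[].
move=> /nbhs_ballP [r /= r0 rB] AB.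
exists r => // y Ay; rewrite leNgt; apply/negP => yr; apply: AB.
by exists y; split=> //; apply: rB; rewrite -ball_normE/= sub0r normrN.
Qed.

Lemma family_R_not0 : ~ A 0.
Proof.
by move=> A0; have [r r0 /(_ _ A0)] := family_R_away0; rewrite normr0 leNgt r0.
Qed.

(** The segment from [0] to a point of the complement stays in the complement,
    so [A] is stable under scaling by [s >= 1]. *)
Lemma family_R_scale y (s : R) : 1 <= s -> A y -> A (s *: y).
Proof.
move=> s1 Ay; apply: contrapT => nAs.
have s0 : 0 < s by apply: lt_le_trans s1.
have := @family_R_conv (s *: y) 0 s^-1 _ _ nAs family_R_not0.
rewrite scalerA mulVf ?gt_eqF// scale1r scaler0 addr0.
by apply; rewrite ?invr_ge0 ?(ltW s0)// invf_le1.
Qed.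

Lemma dilateE (u : R) y : 0 < u -> dilate u A y <-> A (u^-1 *: y).
Proof.
move=> u0; split.
  by move=> [z Az <-]; rewrite scalerA mulVf ?gt_eqF// scale1r.
by move=> Az; exists (u^-1 *: y) => //; rewrite scalerA mulfV ?gt_eqF// scale1r.
Qed.

Lemma gauge_set_ubound y (r : R) : 0 < r -> (forall z, A z -> r <= `|z|) ->
  ubound [set u | 0 < u /\ dilate u A y] (`|y| / r).
Proof.
move=> r0 rA u /= [u0 /(dilateE _ u0) /rA].
rewrite normrZ gtr0_norm ?invr_gt0// => ru.
by rewrite ler_pdivlMr// mulrC -ler_pdivlMr// mulrC.
Qed.

(** Openness of [A] is what allows a strict inequality: a point of [x A] also
    lies in [u A] for some [u] slightly above [x]. *)
Lemma gauge_gtP y (x : R) : 0 < x -> (x < gauge A y) <-> dilate x A y.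
Proof.
move=> x0; have [r r0 rA] := family_R_away0.
have ub := @gauge_set_ubound y r r0 rA.
split.
  rewrite /gauge; have [->|/set0P S0] :=
    eqVneq [set u | 0 < u /\ dilate u A y] set0; first by rewrite sup0 ltNge ltW.
  move=> /(sup_gt S0)[u /= [u0 /(dilateE _ u0) Au] xu].
  apply/(dilateE _ x0).
  have -> : x^-1 *: y = (u / x) *: (u^-1 *: y).
    by rewrite scalerA mulrAC mulfV ?gt_eqF// mul1r.
  by apply: family_R_scale => //; rewrite ler_pdivlMr// mul1r ltW.
move=> /(dilateE _ x0) Ax.
(* [A] is open and contains [x^-1 *: y], hence [u^-1 *: y] for [u] near [x]. *)
have cz : (fun u : R => u^-1 *: y) @ x^'+ --> x^-1 *: y.
  apply: cvg_at_right_filter; apply: cvgZr_tmp; apply: cvgV; last exact: cvg_id.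
  by rewrite gt_eqF.
have oA : open A by case: hA.
have nA : \forall u \near x^'+, A (u^-1 *: y) by apply: cz; exact: open_nbhs_nbhs.
have [u [xu Au]] : exists u, x < u /\ A (u^-1 *: y).
  near (x^'+) => u; exists u; split; near: u; last exact: nA.
  exact: nbhs_right_gt.
have u0 := lt_trans x0 xu.
apply: (lt_le_trans xu); apply: ub_le_sup; first by exists (`|y| / r).
by split=> //; apply/dilateE.
Unshelve. all: by end_near. Qed.

Lemma gauge_ge0 y : 0 <= gauge A y.
Proof.
have [r r0 rA] := family_R_away0.
rewrite /gauge; have [->|/set0P [u Su]] :=
  eqVneq [set u | 0 < u /\ dilate u A y] set0; first by rewrite sup0.
apply: le_trans (ltW (proj1 Su)) _; apply: ub_le_sup => //.
by exists (`|y| / r); exact: gauge_set_ubound.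
Qed.

Lemma gauge_le_norm : exists2 r : R, 0 < r & forall y, gauge A y <= `|y| / r.
Proof.
have [r r0 rA] := family_R_away0; exists r => // y.
rewrite /gauge; have [->|/set0P S0] :=
  eqVneq [set u | 0 < u /\ dilate u A y] set0.
  by rewrite sup0 divr_ge0// ltW.
by apply: ge_sup => //; exact: gauge_set_ubound.
Qed.

Lemma gauge0 : gauge A 0 = 0.
Proof.
apply/eqP; rewrite eq_le gauge_ge0 andbT.
by have [r r0 /(_ 0)] := gauge_le_norm; rewrite normr0 mul0r.
Qed.

Lemma gauge_leP y (x : R) : 0 < x -> (gauge A y <= x) <-> ~ A (x^-1 *: y).
Proof.
move=> x0; rewrite leNgt; split.
  by move=> /negP h Ax; apply: h; apply/gauge_gtP => //; apply/dilateE.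
by move=> h; apply/negP => /(gauge_gtP _ x0)/(dilateE _ x0).
Qed.

(** A point of gauge at most [a] plus one of gauge at most [b] is [a + b] times
    a convex combination of two points of the complement of [A]. *)
Lemma gauge_addv_le x y : gauge A (x + y) <= gauge A x + gauge A y.
Proof.
apply/ler_addgt0Pr => e e0.
pose a := gauge A x + e / 2; pose b := gauge A y + e / 2.
have e2 : 0 < e / 2 by rewrite divr_gt0.
have a0 : 0 < a by rewrite ltr_wpDl// gauge_ge0.
have b0 : 0 < b by rewrite ltr_wpDl// gauge_ge0.
have ab0 : 0 < a + b by rewrite addr_gt0.
have -> : gauge A x + gauge A y + e = a + b by rewrite /a /b; lra.
apply/gauge_leP => //.
have -> : (a + b)^-1 *: (x + y) =
    (a / (a + b)) *: (a^-1 *: x) + (1 - a / (a + b)) *: (b^-1 *: y).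
  rewrite !scalerA scalerDr; congr (_ *: _ + _ *: _).
    by rewrite mulrAC mulfV ?gt_eqF// mul1r.
  rewrite -{1}(mulfV (lt0r_neq0 ab0)) -mulrBl [a + b]addrC.
  by rewrite addrK mulrAC mulfV ?gt_eqF// mul1r.
apply: family_R_conv.
- by rewrite divr_ge0// ltW.
- by rewrite ler_pdivrMr// mul1r lerDl ltW.
- by apply/gauge_leP => //; rewrite /a lerDl ltW.
- by apply/gauge_leP => //; rewrite /b lerDl ltW.
Qed.

Lemma gauge_addv_ge y z : nonneg_vec z -> gauge A y <= gauge A (y + z).
Proof.
move=> z0; apply/ler_addgt0Pr => e e0.
have a0 : 0 < gauge A (y + z) + e by rewrite ltr_wpDl// gauge_ge0.
apply/gauge_leP => // Ay.
have [_ _ iA _ _] := hA.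
have /(gauge_leP _ a0) : gauge A (y + z) <= gauge A (y + z) + e by rewrite lerDl ltW.
apply; rewrite scalerDr; apply: iA => // j; rewrite mxE mulr_ge0//.
by rewrite invr_ge0 ltW.
Qed.

Lemma gaugeZ t y : 0 < t -> gauge A (t *: y) = t * gauge A y.
Proof.
have le s x : 0 < s -> gauge A (s *: x) <= s * gauge A x.
  move=> s0; apply/ler_addgt0Pr => e e0.
  have se0 : 0 < s * gauge A x + e by rewrite ltr_wpDl// mulr_ge0 ?gauge_ge0// ltW.
  apply/gauge_leP => //; rewrite scalerA.
  have -> : (s * gauge A x + e)^-1 * s = ((s * gauge A x + e) / s)^-1.
    by rewrite invf_div mulrC.
  apply/gauge_leP; first by rewrite divr_gt0.
  by rewrite ler_pdivlMr// mulrC lerDl ltW.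
move=> t0; apply/eqP; rewrite eq_le le//=.
rewrite -ler_pdivlMl// -{1}(scale1r y) -(mulVf (lt0r_neq0 t0)) -scalerA.
by apply: le; rewrite invr_gt0.
Qed.

Lemma gauge_continuous : continuous (gauge A).
Proof.
have [r r0 rA] := gauge_le_norm.
move=> x; apply/(@cvgrPdist_le _ _ _ (nbhs x)) => /= e e0.
have : \forall y \near x, `|x - y| <= e * r.
  by apply/nbhs_ballP; exists (e * r); rewrite /= ?mulr_gt0// => y; rewrite -ball_normE => /ltW.
apply: filterS => y; rewrite -ler_pdivrMr// => xyr.
rewrite ler_norml; apply/andP; split.
  rewrite lerNl opprB lerBlDl (le_trans _ (lerD (lexx (gauge A x)) xyr))//.
  have := gauge_addv_le x (y - x).
  rewrite addrC subrK => /le_trans; apply.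
  by rewrite lerD2l (le_trans (rA _))// -opprB normrN.
rewrite lerBlDl (le_trans _ (lerD (lexx (gauge A y)) xyr))//.
have := gauge_addv_le y (x - y).
rewrite addrC subrK => /le_trans; apply.
by rewrite lerD2l (le_trans (rA _)).
Qed.

Lemma open_gauge_gt (x : R) : open [set y | x < gauge A y].
Proof.
rewrite (_ : [set y | x < gauge A y] = gauge A @^-1` `]x, +oo[%classic).
  by apply: open_comp => // y _; exact: gauge_continuous.
by apply/seteqP; split => y /=; rewrite in_itv/= andbT.
Qed.

Lemma dilate_gauge (x : R) : 0 < x -> dilate x A = [set y | x < gauge A y].
Proof. by move=> x0; apply/seteqP; split => y /(gauge_gtP _ x0). Qed.

Lemma nonneg_sum (I : Type) (s : seq I) (Q : pred I) (x : I -> 'rV[R]_d) :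
  (forall i, nonneg_vec (x i)) -> nonneg_vec (\sum_(i <- s | Q i) x i).
Proof. by move=> x0 j; rewrite summxE sumr_ge0// => i _; exact: x0. Qed.

(** The two bounds that reduce the problem to real random variables. *)
Lemma gauge_sum_le n (x : nat -> 'rV[R]_d) :
  gauge A (\sum_(i < n) x i) <= \sum_(i < n) gauge A (x i).
Proof.
elim: n => [|n IH]; first by rewrite !big_ord0 gauge0.
rewrite !big_ord_recr/=; apply: le_trans (gauge_addv_le _ _) _.
by rewrite lerD2r.
Qed.

Lemma gauge_sum_ge n (x : nat -> 'rV[R]_d) i :
  (forall i, nonneg_vec (x i)) -> (i < n)%N ->
  gauge A (x i) <= gauge A (\sum_(i < n) x i).
Proof.
move=> x0 ilt; rewrite (bigD1 (Ordinal ilt))//=; apply: gauge_addv_ge.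
exact: nonneg_sum.
Qed.

Lemma measurable_gauge_gt (x : R) :
  measurable ([set y | x < gauge A y] : set (borel_rV R d)).
Proof. by apply: sub_sigma_algebra; exact: open_gauge_gt. Qed.

End Gauge.

(** * Eventual properties on the half-line *)

Section NearInfinity.
Context {R : realType}.
Implicit Types (Q : R -> Prop) (t : R).

Lemma near_pinftyP Q : (\forall x \near +oo_R, Q x) <->
  exists2 M : R, 0 < M & forall x, M <= x -> Q x.
Proof.
split=> [[M [_ MQ]]|[M M0 MQ]].
  exists (Num.max M 0 + 1).
    by rewrite ltr_wpDl// le_max lexx orbT.
  move=> x Mx; apply: MQ; apply: lt_le_trans Mx.
  by rewrite ltr_pwDr// le_max lexx.
by exists M; split; [exact: num_real|move=> x /ltW; exact: MQ].
Qed.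

Lemma near_pinfty_scale Q t : 0 < t ->
  (\forall x \near +oo_R, Q x) -> \forall x \near +oo_R, Q (t * x).
Proof.
move=> t0 /near_pinftyP[M M0 MQ]; apply/near_pinftyP; exists (M / t).
  by rewrite divr_gt0.
by move=> x; rewrite ler_pdivrMr// mulrC; exact: MQ.
Qed.

Lemma near_pinfty_ge t : \forall x \near +oo_R, t <= x.
Proof. by apply: nbhs_pinfty_ge; exact: num_real. Qed.

Lemma near_pinfty_gt t : \forall x \near +oo_R, t < x.
Proof. by apply: nbhs_pinfty_gt; exact: num_real. Qed.

Lemma cvg_pinfty_scale (f : R -> R) (l : R) t : 0 < t ->
  f x @[x --> +oo_R] --> l -> f (t * x) @[x --> +oo_R] --> l.
Proof.
by move=> t0 fl B /fl; exact: near_pinfty_scale.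
Qed.

End NearInfinity.

(** * Matuszewska index and power bounds on a tail *)

Section Matuszewska.
Context {R : realType} (V : set R -> \bar R).
Hypothesis tail_ge0 : forall x, 0 <= tail V x.
Hypothesis tail_le1 : forall x, tail V x <= 1.
Hypothesis tail_noninc : forall x y, x <= y -> tail V y <= tail V x.
Implicit Types (a v x y : R).

Local Notation q := (liminf_ratio V).

Lemma liminf_ratio_gt a v : (a%:E < q v)%E ->
  \forall x \near +oo_R, a < tail V (v * x) / tail V x.
Proof.
rewrite /liminf_ratio limf_einfE => /ereal_sup_gt[_ [W FW <-] aW].
apply: filterS FW => x Wx; rewrite -lte_fin; apply: lt_le_trans aW _.
by apply: ereal_inf_lbound; exists x.
Qed.

Lemma liminf_ratio_ge a v :
  (\forall x \near +oo_R, a <= tail V (v * x) / tail V x) -> (a%:E <= q v)%E.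
Proof.
move=> Fa; rewrite /liminf_ratio limf_einfE.
apply: (@le_trans _ _ (ereal_inf ((fun x => (tail V (v * x) / tail V x)%:E) @`
    [set x | a <= tail V (v * x) / tail V x]))).
  by apply: le_ereal_inf_tmp => _ [x /= ax <-]; rewrite lee_fin.
by apply: ereal_sup_ubound; exists [set x | a <= tail V (v * x) / tail V x].
Qed.

Lemma liminf_ratio_le a v :
  (\forall x \near +oo_R, tail V (v * x) / tail V x <= a) -> (q v <= a%:E)%E.
Proof.
move=> Fa; rewrite leNgt; apply/negP => /liminf_ratio_gt Fa'.
near (+oo_R) => x.
have : a < tail V (v * x) / tail V x by near: x.
by rewrite ltNge => /negP; apply; near: x.
Unshelve. all: by end_near. Qed.

Lemma tail_ratio_ge0 v x : 0 <= tail V (v * x) / tail V x.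
Proof. by rewrite divr_ge0. Qed.

Lemma tail_ratio_le1 v : 1 <= v ->
  \forall x \near +oo_R, tail V (v * x) / tail V x <= 1.
Proof.
move=> v1; apply/near_pinftyP; exists 1 => // x x1.
have [->|t0] := eqVneq (tail V x) 0; first by rewrite invr0 mulr0.
rewrite ler_pdivrMr ?lt_neqAle 1?eq_sym ?t0//= mul1r.
by apply: tail_noninc; rewrite ler_peMl// (le_trans _ x1).
Qed.

Let r v := fine (q v).

Lemma liminf_ratio_fin v : 1 <= v -> (r v)%:E = q v /\ 0 <= r v <= 1.
Proof.
move=> v1.
have q1 : (q v <= 1)%E by apply: liminf_ratio_le; exact: tail_ratio_le1.
have q0 : (0 <= q v)%E.
  by apply: liminf_ratio_ge; apply: nearW => x; exact: tail_ratio_ge0.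
have qf : q v \is a fin_num.
  by rewrite fin_numE; apply/andP; split; apply/eqP => qv; move: q1 q0; rewrite qv.
by rewrite /r -!lee_fin fineK// q0 q1.
Qed.

Lemma liminf_ratio_noninc u v : 1 <= u -> u <= v -> r v <= r u.
Proof.
move=> u1 uv; have v1 := le_trans u1 uv.
have [qu _] := liminf_ratio_fin u1; have [qv _] := liminf_ratio_fin v1.
rewrite leNgt; apply/negP => ruv.
pose a := (r u + r v) / 2.
have ua : r u < a by rewrite /a; lra.
have av : a < r v by rewrite /a; lra.
have : (a%:E <= q u)%E.
  have : (a%:E < q v)%E by rewrite -qv.
  move=> /liminf_ratio_gt Fa; apply: liminf_ratio_ge; near=> x.
  apply: (@le_trans _ _ (tail V (v * x) / tail V x)); first by apply: ltW; near: x.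
  rewrite ler_wpM2r ?invr_ge0//; apply: tail_noninc.
  by rewrite ler_wpM2r//; near: x; exact: near_pinfty_ge.
by rewrite -qu lee_fin leNgt ua.
Unshelve. all: by end_near. Qed.

(** If the lower limit of the ratios vanishes at one scale it vanishes at all
    larger ones, by monotonicity, and the index is infinite. *)
Lemma Matuszewska_gt0 (p : R) : (upper_Matuszewska V < p%:E)%E ->
  forall v, 1 <= v -> 0 < r v.
Proof.
move=> Jp v v1; have [rv /andP[r0 _]] := liminf_ratio_fin v1.
rewrite lt_neqAle r0 andbT; apply/eqP => /esym rv0.
suff : upper_Matuszewska V = +oo%E by move=> J; move: Jp; rewrite J.
suff qNy : (lne (liminf_ratio V u) / (ln u)%:E @[u --> +oo_R] --> -oo)%E.
  by rewrite /upper_Matuszewska (cvg_lim _ qNy).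
apply: cvg_near_cst; apply/near_pinftyP; exists (v + 1).
  by rewrite ltr_wpDl// (le_trans ler01).
move=> u vu; have u1 : 1 < u by rewrite (lt_le_trans _ vu)// (le_lt_trans v1)// ltrDl.
rewrite le0_lneNy.
  by rewrite inver gt_eqF ?ln_gt0// gt0_mulNye// lte_fin invr_gt0 ln_gt0.
have [<- _] := liminf_ratio_fin (ltW u1).
by rewrite lee_fin -rv0 liminf_ratio_noninc// (le_trans _ vu)// lerDl.
Qed.

(** A tail that is eventually zero has ratios [0 / 0 = 0], hence infinite index:
    a finite index forces the tail to be positive. *)
Lemma Matuszewska_tail_gt0 (p : R) : (upper_Matuszewska V < p%:E)%E ->
  forall x, 0 < tail V x.
Proof.
move=> Jp y; rewrite lt_neqAle tail_ge0 andbT; apply/eqP => /esym y0.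
have r1 := Matuszewska_gt0 Jp (lexx 1).
have [q1 _] := liminf_ratio_fin (lexx 1).
have : (q 1 <= 0)%E.
  apply: liminf_ratio_le; apply/near_pinftyP; exists (Num.max 1 y).
    by rewrite lt_max ltr01.
  move=> x; rewrite ge_max => /andP[_ yx]; rewrite mul1r.
  suff -> : tail V x = 0 by rewrite mul0r.
  by apply/eqP; rewrite eq_le tail_ge0 andbT -y0 tail_noninc.
by rewrite -q1 lee_fin leNgt r1.
Qed.

Section Fekete.
Hypothesis tail_gt0 : forall x, 0 < tail V x.
Hypothesis r_gt0 : forall v, 1 <= v -> 0 < r v.

(** Supermultiplicativity, the input of Fekete's argument: the ratio of the tails
    at [u * v * x] and [x] is the product of the ratios at the scales [u] and
    [v]. *)
Lemma liminf_ratioM u v : 1 <= u -> 1 <= v -> r u * r v <= r (u * v).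
Proof.
move=> u1 v1; have uv1 : 1 <= u * v by rewrite mulr_ege1.
have [qu _] := liminf_ratio_fin u1; have [qv _] := liminf_ratio_fin v1.
have [quv _] := liminf_ratio_fin uv1.
have small w (e : R) : 1 <= w -> 0 < e -> e < 1 ->
    \forall x \near +oo_R, (1 - e) * r w * tail V x <= tail V (w * x).
  move=> w1 e0 e1; have [qw _] := liminf_ratio_fin w1.
  have /liminf_ratio_gt : (((1 - e) * r w)%:E < q w)%E.
    by rewrite -qw lte_fin gtr_pMl ?r_gt0// ltrBlDr ltrDl.
  by apply: filterS => x; rewrite ltr_pdivlMr// => /ltW.
apply/ler_addgt0Pr => e e0.
(* The product of the lower bounds loses at most [2 * e'], since the limits are
   at most 1. *)
pose e' := Num.min (e / 2) (1 / 2).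
have e'0 : 0 < e' by rewrite lt_min !divr_gt0.
have e'1 : e' < 1 by rewrite gt_min; apply/orP; right; lra.
have e'e : 2 * e' <= e.
  rewrite mulrC -ler_pdivlMr//; by rewrite ge_min lexx.
have h : (1 - e') * r u * ((1 - e') * r v) <= r (u * v).
  rewrite -lee_fin quv; apply: liminf_ratio_ge.
  have Hv := small v e' v1 e'0 e'1.
  have v0 : 0 < v by apply: lt_le_trans v1.
  have Hu := near_pinfty_scale v0 (small u e' u1 e'0 e'1).
  near=> x.
  rewrite ler_pdivlMr// -[u * v * x]mulrA.
  apply: (@le_trans _ _ ((1 - e') * r u * tail V (v * x))); last by near: x.
  rewrite -!mulrA !(ler_pM2l, r_gt0) ?subr_gt0// mulrA.
  by near: x.
apply: le_trans (lerD h e'e); rewrite -subr_ge0.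
have [_ /andP[ru0 ru1]] := liminf_ratio_fin u1.
have [_ /andP[rv0 rv1]] := liminf_ratio_fin v1.
have uv0 : 0 <= r u * r v by exact: mulr_ge0.
have uvle1 : r u * r v <= 1 by rewrite mulr_ile1.
by nra.
Unshelve. all: by end_near. Qed.

Lemma liminf_ratioX u k : 1 <= u -> r u ^+ k.+1 <= r (u ^+ k.+1).
Proof.
move=> u1; elim: k => [|k IH]; first by rewrite !expr1.
rewrite exprS [u ^+ _]exprS (le_trans _ (liminf_ratioM u1 _))//.
  by rewrite ler_pM2l// r_gt0.
by rewrite exprn_ege1.
Qed.

Let h v := ln (r v) / ln v.

Lemma ln_liminf_ratio_le0 v : 1 <= v -> ln (r v) <= 0.
Proof.
by move=> v1; have [_ /andP[_ ?]] := liminf_ratio_fin v1; rewrite ln_le0.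
Qed.

(** One value of the slope [ln (r u) / ln u] bounds all later ones from below,
    up to an error of order [1 / ln v]: bound [v] above by a power of [u]. *)
Lemma slope_ge u v : 1 < u -> u <= v -> h u + ln (r u) / ln v <= h v.
Proof.
move=> u1 uv; have v1 := lt_le_trans u1 uv.
have lu := ln_gt0 u1; have lv := ln_gt0 v1.
set k := Num.trunc (ln v / ln u).
have /andP[kle ltk] : k%:R <= ln v / ln u < k.+1%:R.
  by apply: truncn_itv; rewrite divr_ge0// ltW.
have u0 : 0 < u by apply: lt_trans u1.
have v0 : 0 < v by apply: lt_trans v1.
have vle : v <= u ^+ k.+1.
  rewrite -(ler_ln (x:=v))// ?posrE ?exprn_gt0// lnXn//.
  by rewrite ltW// -mulr_natl -ltr_pdivrMr.
have ru := r_gt0 (ltW u1); have rv := r_gt0 (ltW v1).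
have : r u ^+ k.+1 <= r v.
  exact: le_trans (liminf_ratioX k (ltW u1)) (liminf_ratio_noninc (ltW v1) vle).
rewrite -ler_ln ?posrE ?exprn_gt0// lnXn// -mulr_natl => le_ln.
rewrite /h ler_pdivlMr// mulrDl divfK ?gt_eqF//.
apply: le_trans le_ln; rewrite -[k.+1]addn1 natrD mulrDl mul1r lerD2r.
rewrite (_ : ln (r u) / ln u * ln v = ln v / ln u * ln (r u)); last first.
  by rewrite mulrC [RHS]mulrAC mulrA.
by rewrite ler_wnM2r// ln_liminf_ratio_le0// ltW.
Qed.

(** The limit is the supremum of the slopes over [v > 1]. *)
Lemma slope_cvg : exists L : R, h v @[v --> +oo_R] --> L.
Proof.
pose S := [set h v | v in [set v | 1 < v]].
have S0 : S !=set0 by exists (h 2), 2; rewrite /=; lra.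
have Sub : has_ubound S.
  exists 0 => _ [v /= v1 <-]; rewrite /h pmulr_lle0 ?invr_gt0 ?ln_gt0//.
  by rewrite ln_liminf_ratio_le0// ltW.
have hub v : 1 < v -> h v <= sup S by move=> v1; apply: ub_le_sup => //; exists v.
exists (sup S); apply/cvgrPdist_le => /= e e0.
have e2 : 0 < e / 2 by rewrite divr_gt0.
have [_ [u /= u1 <-] hu] := sup_adherent e2 (conj S0 Sub).
near=> v.
have uv : u <= v by near: v; exact: near_pinfty_ge.
have v1 := lt_le_trans u1 uv.
have lv := ln_gt0 v1.
rewrite ger0_norm ?subr_ge0 ?hub//.
have lnv : - ln (r u) / ln v <= e / 2.
  rewrite ler_pdivrMr// mulrC -ler_pdivrMr//.
  rewrite -ler_expR [leRHS]lnK; last by rewrite posrE (lt_trans ltr01).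
  by near: v; exact: near_pinfty_ge.
have := slope_ge u1 uv.
by move: lnv hu; rewrite mulNr; lra.
Unshelve. all: by end_near. Qed.

End Fekete.

(** As the slopes converge to minus the index, some slope exceeds [- p], which
    says that the tail at [v * x] is at least [v ^ (- p)] times the tail at [x]
    for that single scale [v]. *)
Lemma Matuszewska_scale (p : R) : (upper_Matuszewska V < p%:E)%E ->
  0 < p /\ exists2 v, 1 < v &
    \forall x \near +oo_R, v `^ (- p) * tail V x <= tail V (v * x).
Proof.
move=> Jp; have r0 := Matuszewska_gt0 Jp; have t0 := Matuszewska_tail_gt0 Jp.
have [L hL] := slope_cvg t0 r0.
pose h v := ln (r v) / ln v.
have JL : upper_Matuszewska V = (- L%:E)%E.
  rewrite /upper_Matuszewska; congr (- _)%E; apply: cvg_lim => //.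
  apply: (@cvg_trans _ ((h v)%:E @[v --> +oo_R])); last first.
    by apply: cvg_EFin => //; exact: nearW.
  apply: near_eq_cvg; apply/near_pinftyP; exists 2 => // v v2.
  have v1 : 1 < v by lra.
  have [<- _] := liminf_ratio_fin (ltW v1).
  by rewrite lne_EFin ?r0 ?ltW// inver gt_eqF ?ln_gt0.
move: Jp; rewrite JL -EFinN lte_fin ltrNl => pL.
have [v [v1 hv]] : exists v, 1 < v /\ - p < h v.
  near (+oo_R) => v; exists v; split; near: v; first exact: near_pinfty_gt.
  exact: (cvgr_gt _ hL).
have [qv /andP[_ rv1]] := liminf_ratio_fin (ltW v1).
have lv := ln_gt0 v1; have rv0 := r0 _ (ltW v1).
have v0 : 0 < v by apply: lt_trans v1.
split.
  rewrite -oppr_lt0 (lt_le_trans hv)// /h pmulr_lle0 ?invr_gt0//.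
  by rewrite ln_le0.
exists v => //.
have : v `^ (- p) < r v.
  rewrite -ltr_ln ?posrE ?powR_gt0// ln_powR -ltr_pdivlMr//.
rewrite -lte_fin qv => /liminf_ratio_gt; apply: filterS => x.
by rewrite ltr_pdivlMr// => /ltW.
Unshelve. all: by end_near. Qed.

(** Iterating the bound at the scale [v] gives it at all powers of [v], and
    monotonicity at the scales in between.  The bound also covers [x / s] below
    the threshold [x0]: there the left side is at most 1 and [s] is so large
    that the right side exceeds 1. *)
Lemma Matuszewska_power_bound (p : R) : (upper_Matuszewska V < p%:E)%E ->
  exists C x0 : R, [/\ 0 < C, 0 < x0 & forall s x, 1 <= s -> x0 <= x ->
    tail V (x / s) <= C * s `^ p * tail V x].
Proof.
move=> Jp; have t0 := Matuszewska_tail_gt0 Jp.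
have [p0 [v v1 /near_pinftyP[x0 x00 Hv]]] := Matuszewska_scale Jp.
have v0 : 0 < v by apply: lt_trans v1.
have lv := ln_gt0 v1.
have iter k x : x0 <= x -> (v ^+ k) `^ (- p) * tail V x <= tail V (v ^+ k * x).
  move=> x0x; elim: k => [|k IH]; first by rewrite expr0 powR1 !mul1r.
  rewrite exprS powRM ?exprn_ge0 ?(ltW v0)// -mulrA -[v * _ * x]mulrA.
  apply: (@le_trans _ _ (v `^ (- p) * tail V (v ^+ k * x))).
    by rewrite ler_wpM2l// powR_ge0.
  apply: Hv; rewrite (le_trans x0x)// ler_peMl//; last by rewrite exprn_ege1// ltW.
  by rewrite (le_trans _ x0x)// ltW.
have up s y : 1 <= s -> x0 <= y -> tail V y <= v `^ p * s `^ p * tail V (s * y).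
  move=> s1 x0y; have s0 : 0 < s by apply: lt_le_trans s1.
  set k := Num.trunc (ln s / ln v).
  have /andP[kle ltk] : k%:R <= ln s / ln v < k.+1%:R.
    by apply: truncn_itv; rewrite divr_ge0 ?ln_ge0// ltW.
  have sle : s <= v ^+ k.+1.
    rewrite -ler_ln ?posrE ?exprn_gt0// lnXn//.
    by rewrite ltW// -mulr_natl -ltr_pdivrMr.
  have les : v ^+ k <= s.
    by rewrite -ler_ln ?posrE ?exprn_gt0// lnXn// -mulr_natl -ler_pdivlMr.
  have y0 : 0 < y by apply: lt_le_trans x0y.
  have vk : tail V y <= (v ^+ k.+1) `^ p * tail V (v ^+ k.+1 * y).
    have := iter k.+1 y x0y.
    by rewrite powRN mulrC ler_pdivrMr ?powR_gt0 ?exprn_gt0// mulrC.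
  apply: le_trans vk _; apply: ler_pM => //; first exact: powR_ge0.
    rewrite exprS powRM ?exprn_ge0 ?(ltW v0)// ler_wpM2l ?powR_ge0//.
    by apply: ge0_ler_powR => //; rewrite ?nnegrE ?ltW// exprn_gt0.
  by apply: tail_noninc; rewrite ler_pM2r.
exists (v `^ p / tail V x0), x0; split=> //.
  by rewrite divr_gt0// powR_gt0.
move=> s x s1 x0x; have s0 : 0 < s by apply: lt_le_trans s1.
have x00' : 0 < x by apply: lt_le_trans x0x.
have c1 : 1 <= (tail V x0)^-1 by rewrite invf_ge1.
have [x0s|sx0] := leP x0 (x / s).
  apply: le_trans (up s _ s1 x0s) _.
  rewrite mulrCA mulfV ?gt_eqF// mulr1.
  by rewrite ler_wpM2r// ler_wpM2r ?powR_ge0// ler_peMr ?powR_ge0.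
apply: le_trans (tail_le1 _) _.
have x1 : 1 <= x / x0 by rewrite ler_pdivlMr// mul1r.
have := up (x / x0) x0 x1 (lexx _); rewrite divfK ?gt_eqF// => le0.
have le1 : tail V x0 <= v `^ p * s `^ p * tail V x.
  apply: le_trans le0 _; rewrite ler_wpM2r// ler_wpM2l ?powR_ge0//.
  apply: ge0_ler_powR; rewrite ?nnegrE ?ltW//; first by rewrite divr_gt0.
  by rewrite ltr_pdivrMr// mulrC -ltr_pdivrMr.
by rewrite -mulrA mulrAC mulrA ler_pdivlMr// mul1r.
Qed.

End Matuszewska.

(** * Tail classes and tail equivalence *)

Section TailClassLemmas.
Context {R : realType}.
Implicit Types (V W : set R -> \bar R) (a b c e x y : R).

Lemma limsup_ratio_lt V a b : (limsup_ratio V b < a%:E)%E ->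
  \forall x \near +oo_R, tail V (b * x) / tail V x < a.
Proof.
rewrite /limsup_ratio limf_esupE => /ereal_inf_lt[_ [U FU <-] aU].
apply: filterS FU => x Ux; rewrite -lte_fin; apply: le_lt_trans aU.
by apply: ereal_sup_ubound; exists x.
Qed.

Lemma limsup_ratio_le V a b :
  (\forall x \near +oo_R, tail V (b * x) / tail V x <= a) ->
  (limsup_ratio V b <= a%:E)%E.
Proof.
move=> Fa; rewrite /limsup_ratio limf_esupE.
apply: (@le_trans _ _ (ereal_sup ((fun x => (tail V (b * x) / tail V x)%:E) @`
    [set x | tail V (b * x) / tail V x <= a]))).
  by apply: ereal_inf_lbound; exists [set x | tail V (b * x) / tail V x <= a].
by apply: ge_ereal_sup => _ [x /= ax <-]; rewrite lee_fin.
Qed.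

Lemma limsup_ratio_ge0 V b : tail_pos V -> 0 < b -> (0 <= limsup_ratio V b)%E.
Proof.
move=> V0 b0; rewrite leNgt; apply/negP => /limsup_ratio_lt Fx.
near (+oo_R) => x.
have x0 : 0 <= x by near: x; exact: near_pinfty_ge.
have : tail V (b * x) / tail V x < 0 by near: x.
by rewrite ltNge divr_ge0// ltW// V0// mulr_ge0// ltW.
Unshelve. all: by end_near. Qed.

Lemma class_C_near V e : class_C V -> 0 < e ->
  exists2 dl, 0 < dl < 1 &
    \forall x \near +oo_R, tail V ((1 - dl) * x) <= (1 + e) * tail V x.
Proof.
move=> [V0 VC] e0.
have VCe : \forall b \near 1^'-, (limsup_ratio V b < (1 + e)%:E)%E.
  apply: (VC [set y | (y < (1 + e)%:E)%E]); apply: open_nbhs_nbhs.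
  by split; [exact: open_ereal_lt_ereal|rewrite /= lte_fin ltrDl].
have [b [b0 b1 /limsup_ratio_lt Vb]] : exists b,
    [/\ 0 < b, b < 1 & (limsup_ratio V b < (1 + e)%:E)%E].
  near ((1 : R)^'-) => b; exists b; split; near: b; last exact: VCe.
    exact: nbhs_left_gt.
  exact: nbhs_left_lt.
exists (1 - b); first by rewrite subr_gt0 b1 ltrBlDr ltrDl b0.
rewrite opprB addrCA subrr addr0; near=> x.
have tx : 0 < tail V x by apply: V0; near: x; exact: near_pinfty_ge.
by rewrite -ler_pdivrMr// ltW//; near: x.
Unshelve. all: by end_near. Qed.

Lemma class_L_near V y e : class_L V -> 0 < y -> 0 < e ->
  \forall x \near +oo_R, tail V (x - y) <= (1 + e) * tail V x.
Proof.
move=> [V0 VL] y0 e0; have := VL y y0.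
move=> /cvgrPdist_lt/(_ _ e0) Fe; near=> x.
have tx : 0 < tail V x by apply: V0; near: x; exact: near_pinfty_ge.
rewrite -ler_pdivrMr// -lerBlDl.
rewrite (le_trans (ler_norm _))// distrC ltW//.
by near: x.
Unshelve. all: by end_near. Qed.

(** Stability of the classes under tail equivalence: the quotient of the two
    tails tends to the same constant at [b * x] and at [x], so it cancels in the
    ratios that define the classes. *)
Section Equivalence.
Context (V W : set R -> \bar R) (c : R).
Hypothesis c0 : 0 < c.
Hypothesis V_gt0 : tail_pos V.
Hypothesis W_gt0 : tail_pos W.
Hypothesis VW : tail W x / tail V x @[x --> +oo_R] --> c.

Lemma tail_equiv_sym : tail V x / tail W x @[x --> +oo_R] --> c^-1.
Proof.
apply: cvg_trans (cvgV (lt0r_neq0 c0) VW); apply: near_eq_cvg.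
by apply: nearW => x /=; rewrite invf_div.
Qed.

Lemma tail_equiv_double_ratio b : 0 < b ->
  (tail W (b * x) / tail V (b * x)) / (tail W x / tail V x) @[x --> +oo_R]
    --> (1 : R).
Proof.
move=> b0; rewrite -(mulfV (lt0r_neq0 c0)); apply: cvgM.
  exact: (@cvg_pinfty_scale _ (fun x => tail W x / tail V x)).
by apply: cvgV => //; rewrite gt_eqF.
Qed.

Lemma limsup_ratio_equiv_le b : 0 < b ->
  (limsup_ratio W b <= limsup_ratio V b)%E.
Proof.
move=> b0; have := limsup_ratio_ge0 V_gt0 b0.
case l : (limsup_ratio V b) => [r| |//] r0; last exact: leey.
apply/lee_addgt0Pr => e e0; rewrite lee_fin in r0.
have e2 : 0 < e / 2 by rewrite divr_gt0.
have re0 : 0 < r + e / 2 by rewrite ltr_wpDl.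
have /limsup_ratio_lt FV : (limsup_ratio V b < (r + e / 2)%:E)%E.
  by rewrite l lte_fin ltrDl.
have k1 : 1 < (r + e) / (r + e / 2) by rewrite ltr_pdivlMr// mul1r; lra.
have FK : \forall x \near +oo_R, tail W (b * x) / tail V (b * x) / (tail W x / tail V x)
    < (r + e) / (r + e / 2) by apply: (cvgr_lt 1 (tail_equiv_double_ratio b0)).
rewrite -EFinD; apply: limsup_ratio_le; near=> x.
have x0 : 0 <= x by near: x; exact: near_pinfty_ge.
have Vx := V_gt0 x0; have Wx := W_gt0 x0.
have Vbx : 0 < tail V (b * x) by apply: V_gt0; rewrite mulr_ge0// ltW.
have Wbx : 0 < tail W (b * x) by apply: W_gt0; rewrite mulr_ge0// ltW.
have -> : tail W (b * x) / tail W x =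
   (tail W (b * x) / tail V (b * x)) / (tail W x / tail V x) *
   (tail V (b * x) / tail V x).
  by field; rewrite !gt_eqF.
rewrite -[leRHS](@divfK _ (r + e / 2)) ?gt_eqF//.
apply: ler_pM; rewrite ?divr_ge0 ?(ltW Wbx) ?(ltW Vbx) ?(ltW Vx) ?(ltW Wx)//.
  by apply: ltW; near: x.
by apply: ltW; near: x.
Unshelve. all: by end_near. Qed.

End Equivalence.

Section EquivalenceClasses.
Context (V W : set R -> \bar R) (c : R).
Hypothesis c0 : 0 < c.
Hypothesis W_noninc : forall x y, x <= y -> tail W y <= tail W x.
Hypothesis V_gt0 : tail_pos V.
Hypothesis VW : tail W x / tail V x @[x --> +oo_R] --> c.

Lemma tail_pos_equiv : tail_pos W.
Proof.
move=> x x0; have FW : \forall y \near +oo_R, 0 < tail W y / tail V y by apply: (cvgr_gt c VW).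
near (+oo_R) => y.
have y0 : x <= y by near: y; exact: near_pinfty_ge.
apply: lt_le_trans (W_noninc y0).
have : 0 < tail W y / tail V y by near: y.
by rewrite pmulr_lgt0// invr_gt0 V_gt0// (le_trans x0).
Unshelve. all: by end_near. Qed.

Lemma limsup_ratio_equiv b : 0 < b -> limsup_ratio W b = limsup_ratio V b.
Proof.
move=> b0; apply/eqP; rewrite eq_le.
rewrite (limsup_ratio_equiv_le c0 V_gt0 tail_pos_equiv VW b0)/=.
apply: (limsup_ratio_equiv_le _ tail_pos_equiv V_gt0 _ b0); last first.
  exact: (tail_equiv_sym c0).
by rewrite invr_gt0.
Qed.

Lemma class_C_equiv : class_C V -> class_C W.
Proof.
move=> [_ VC]; split; first exact: tail_pos_equiv.
apply: cvg_trans VC; apply: near_eq_cvg; near=> b.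
by rewrite limsup_ratio_equiv//; near: b; exact: nbhs_left_gt.
Unshelve. all: by end_near. Qed.

Lemma class_D_equiv : class_D V -> class_D W.
Proof.
move=> [_ VD]; split; first exact: tail_pos_equiv.
by move=> b b01; rewrite limsup_ratio_equiv; [exact: VD|case/andP: b01].
Qed.

Lemma class_L_equiv : class_L V -> class_L W.
Proof.
move=> [_ VL]; split; first exact: tail_pos_equiv.
move=> y y0.
have shift : (fun x : R => tail W (x - y) / tail V (x - y)) @ +oo_R --> c.
  move=> B /VW /near_pinftyP[M M0 MB]; apply/near_pinftyP; exists (M + y).
    by rewrite addr_gt0.
  by move=> x Mx; apply: MB; rewrite lerBrDr.
have H : tail V (x - y) / tail V x * (tail W (x - y) / tail V (x - y) *
    (tail W x / tail V x)^-1) @[x --> +oo_R] --> 1 * (c * c^-1).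
  apply: cvgM; first exact: VL.
  by apply: cvgM => //; apply: cvgV => //; rewrite gt_eqF.
rewrite mulfV ?lt0r_neq0// mulr1 in H; apply: cvg_trans H.
apply: near_eq_cvg; near=> x.
have xy : 0 <= x - y by rewrite subr_ge0; near: x; exact: near_pinfty_ge.
have x0 : 0 <= x by near: x; exact: near_pinfty_ge.
have Vx := V_gt0 x0; have Wx := tail_pos_equiv x0.
have Vxy := V_gt0 xy; have Wxy := tail_pos_equiv xy.
by rewrite /=; field; rewrite !gt_eqF.
Unshelve. all: by end_near. Qed.

Lemma class_DL_equiv : class_DL V -> class_DL W.
Proof. by move=> [VD VL]; split; [exact: class_D_equiv|exact: class_L_equiv]. Qed.

End EquivalenceClasses.

End TailClassLemmas.

(** * Bounds on the tail of a sum of finitely many terms *)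

Section RealProbability.
Context {R : realType} {dO : measure_display} {Omega : measurableType dO}.
Variable P : probability Omega R.
Implicit Types E H : set Omega.

Lemma probE E : measurable E -> (prob P E)%:E = P E.
Proof. by move=> mE; rewrite /prob fineK// fin_num_measure. Qed.

Lemma prob_ge0 E : 0 <= prob P E.
Proof. by rewrite fine_ge0. Qed.

Lemma prob_le E H : measurable E -> measurable H -> E `<=` H ->
  prob P E <= prob P H.
Proof. by move=> mE mH EH; rewrite -lee_fin !probE// le_measure// inE. Qed.

Lemma prob_le1 E : measurable E -> prob P E <= 1.
Proof. by move=> mE; rewrite -lee_fin probE// probability_le1. Qed.

Lemma probUE E H : measurable E -> measurable H ->
  prob P (E `|` H) + prob P (E `&` H) = prob P E + prob P H.
Proof.
move=> mE mH; apply: EFin_inj; rewrite !EFinD !probE//; last 2 first.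
- exact: measurableI.
- exact: measurableU.
rewrite measureUfinl//; last by rewrite ltey_eq fin_num_measure.
by rewrite subeK// fin_num_measure//; exact: measurableI.
Qed.

Lemma prob_bigsetU_le (I : Type) (s : seq I) (Q : pred I) (E : I -> set Omega) :
  (forall i, measurable (E i)) ->
  prob P (\big[setU/set0]_(i <- s | Q i) E i) <= \sum_(i <- s | Q i) prob P (E i).
Proof.
move=> mE; elim: s => [|i s IH]; first by rewrite !big_nil /prob measure0.
rewrite !big_cons; case: ifP => // _.
have mU : measurable (\big[setU/set0]_(j <- s | Q j) E j).
  exact: bigsetU_measurable.
apply: le_trans (_ : prob P (E i) + prob P (\big[setU/set0]_(j <- s | Q j) E j) <= _).
  rewrite -probUE// lerDl; exact: prob_ge0.
by rewrite lerD2l.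
Qed.

Lemma prob_le_sum (I : finType) (Q : pred I) (E : I -> set Omega) H :
  measurable H -> (forall i, measurable (E i)) ->
  (forall w, H w -> exists2 i, Q i & E i w) ->
  prob P H <= \sum_(i | Q i) prob P (E i).
Proof.
move=> mH mE HE; apply: le_trans (prob_bigsetU_le _ _ mE).
apply: prob_le => //; first exact: bigsetU_measurable.
by move=> w /HE[i Qi Ei]; rewrite (bigD1 i)//=; left.
Qed.

End RealProbability.

Lemma exists_gt_mean (R : realFieldType) (I : finType) (Q : pred I) (f : I -> R)
    (n : nat) (x : R) : (#|Q| <= n)%N -> 0 <= x ->
  x < \sum_(i | Q i) f i -> exists2 i, Q i & x / n%:R < f i.
Proof.
move=> Qn x0; apply: contraPP => /forall2NP h; apply/negP; rewrite -leNgt.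
have [n0|n0] := posnP n.
  rewrite big_pred0 // => i; apply/negP => Qi; move: Qn.
  by rewrite n0 leqNgt => /negP; apply; apply/card_gt0P; exists i.
apply: (@le_trans _ _ (\sum_(i | Q i) x / n%:R)).
  by apply: ler_sum => i Qi; case: (h i) => // /negP; rewrite -leNgt.
rewrite sumr_const -[_ *+ #|_|]mulr_natl mulrCA ler_piMr// ler_pdivrMr ?ltr0n//.
by rewrite mul1r ler_nat.
Qed.


(** In the intended application [Y i] is the gauge of the [i]-th vector and [T n]
    the gauge of the sum of the first [n].  The dependence between the [Y i]
    enters only through the probabilities of pairs of exceedances. *)
Section FixedNumberOfTerms.
Context {R : realType} {dO : measure_display} {Omega : measurableType dO}.
Variable P : probability Omega R.
Variables (Y T : nat -> Omega -> R) (G : R -> R).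
Hypothesis mY : forall i x, measurable [set w | x < Y i w].
Hypothesis mT : forall n x, measurable [set w | x < T n w].
Hypothesis T_le : forall n w, T n w <= \sum_(i < n) Y i w.
Hypothesis T_ge : forall n i w, (i < n)%N -> Y i w <= T n w.
Hypothesis PY : forall i x, prob P [set w | x < Y i w] = G x.

Let both i j (x y : R) : set Omega :=
  [set w | x < Y i w] `&` [set w | y < Y j w].

Let mboth i j x y : measurable (both i j x y).
Proof. exact: measurableI. Qed.

Lemma tail_sum_le_mean n x : 0 <= x -> prob P [set w | x < T n w] <= n%:R * G (x / n%:R).
Proof.
move=> x0; apply: le_trans (_ : \sum_(i < n) prob P [set w | x / n%:R < Y i w] <= _).
  apply: prob_le_sum => // w /= xT.
  apply: (@exists_gt_mean _ _ xpredT (fun i : 'I_n => Y i w)) => //.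
    by rewrite cardT size_enum_ord.
  exact: lt_le_trans (T_le _ _).
by under eq_bigr do rewrite PY; rewrite sumr_const card_ord mulr_natl.
Qed.

(** Either a single term nearly reaches [x], or two different terms are large:
    the largest one exceeds the mean [x / n], and the others together exceed
    [a]. *)
Lemma tail_sum_le_pairs n x a : 0 <= a -> 0 <= x ->
  prob P [set w | x < T n w] <= n%:R * G (x - a) +
    \sum_(ij : 'I_n * 'I_n | ij.1 != ij.2)
      prob P (both ij.1 ij.2 (x / n%:R) (a / n%:R)).
Proof.
move=> a0 x0.
pose H1 := \big[setU/set0]_(i < n) [set w | x - a < Y i w].
pose H2 := \big[setU/set0]_(ij : 'I_n * 'I_n | ij.1 != ij.2)
  both ij.1 ij.2 (x / n%:R) (a / n%:R).
have mH1 : measurable H1 by exact: bigsetU_measurable.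
have mH2 : measurable H2 by exact: bigsetU_measurable.
have sub : [set w | x < T n w] `<=` H1 `|` H2.
  move=> w /= xT; have xS := lt_le_trans xT (T_le n w).
  have [[i xai]|/forallNP small] := pselect (exists i : 'I_n, x - a < Y i w).
    by left; rewrite /H1 (bigD1 i)//=; left.
  right; have [|//|i _ xi] := @exists_gt_mean _ _ xpredT (fun i : 'I_n => Y i w) n x _ _ xS.
    by rewrite cardT size_enum_ord.
  have [| |j ji aj] := @exists_gt_mean _ _ (fun j => j != i) (fun j : 'I_n => Y j w) n a _ a0.
  - by rewrite (leq_trans (max_card _))// card_ord.
  - have := xS; rewrite (bigD1 i)//= => xS'.
    have := small i => /negP; rewrite -leNgt; lra.
  by rewrite /H2 (bigD1 (i, j))//=; [left|rewrite eq_sym].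
apply: le_trans (_ : prob P H1 + prob P H2 <= _).
  rewrite -probUE// (le_trans (prob_le P _ _ sub))//; first exact: measurableU.
  by rewrite lerDl prob_ge0.
apply: lerD; last exact: prob_bigsetU_le.
apply: le_trans (prob_bigsetU_le _ _ _ _) _ => //.
by under eq_bigr do rewrite PY; rewrite sumr_const card_ord mulr_natl.
Qed.

(** Bonferroni's inequality for the event that some [Y i] exceeds [x], which is
    contained in the event that [T n] does. *)
Lemma tail_sum_ge_pairs n x : n%:R * G x -
    \sum_(ij : 'I_n * 'I_n | ij.1 != ij.2) prob P (both ij.1 ij.2 x x) <=
  prob P [set w | x < T n w].
Proof.
pose U k := \big[setU/set0]_(i < k) [set w | x < Y i w].
have mU k : measurable (U k) by exact: bigsetU_measurable.
have bonf k : k%:R * G x - \sum_(i < k) \sum_(j < i) prob P (both i j x x) <=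
    prob P (U k).
  elim: k => [|k IH]; first by rewrite big_ord0 mul0r subr0 prob_ge0.
  rewrite big_ord_recr/= /U big_ord_recr/= -/(U k).
  have := probUE P (mU k) (mY k x); rewrite PY.
  have : prob P (U k `&` [set w | x < Y k w]) <= \sum_(j < k) prob P (both k j x x).
    apply: prob_le_sum => //; first exact: measurableI.
    move=> w [Uw xk].
    have [j jw] : exists j : 'I_k, x < Y j w.
      apply: contrapT => /forallNP nj; move: Uw; rewrite /U.
      by elim/big_ind: _ => [//|A B nA nB [/nA|/nB]//|i _ /nj].
    by exists j.
  by rewrite -natr1 mulrDl mul1r; move: IH; lra.
apply: le_trans (_ : prob P (U n) <= _); last first.
  apply: prob_le => // w; rewrite /U.
  elim/big_ind: _ => [//|A B nA nB [/nA|/nB]//|i _ /= xi].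
  exact: lt_le_trans xi (T_ge _ _).
apply: le_trans (bonf n); rewrite lerD2l lerN2.
rewrite -(pair_big_dep xpredT (fun i j : 'I_n => i != j)
   (fun i j : 'I_n => prob P (both i j x x)))/=.
apply: ler_sum => i _.
rewrite (big_ord_widen n (fun j => prob P (both i j x x)))/=; last first.
  exact: ltnW.
rewrite big_mkcond [leRHS]big_mkcond/=; apply: ler_sum => j _.
case: ifP => [ji|_]; last by case: ifP => // _; exact: prob_ge0.
by rewrite ifT// -val_eqE/= gtn_eqF.
Qed.

End FixedNumberOfTerms.

Section FixedNumberAsymptotics.
Context {R : realType} {dO : measure_display} {Omega : measurableType dO}.
Variable P : probability Omega R.
Variables (Y T : nat -> Omega -> R) (G : R -> R).
Hypothesis mY : forall i x, measurable [set w | x < Y i w].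
Hypothesis mT : forall n x, measurable [set w | x < T n w].
Hypothesis T_le : forall n w, T n w <= \sum_(i < n) Y i w.
Hypothesis T_ge : forall n i w, (i < n)%N -> Y i w <= T n w.
Hypothesis PY : forall i x, prob P [set w | x < Y i w] = G x.
Hypothesis G_gt0 : forall x, 0 < G x.
Variables (C x0 p : R).
Hypothesis C_gt0 : 0 < C.
Hypothesis x0_gt0 : 0 < x0.
Hypothesis G_power : forall s x, 1 <= s -> x0 <= x -> G (x / s) <= C * s `^ p * G x.

Let both i j (x y : R) : set Omega :=
  [set w | x < Y i w] `&` [set w | y < Y j w].

Let mboth i j x y : measurable (both i j x y).
Proof. exact: measurableI. Qed.

Lemma tail_sum0 x : 0 <= x -> prob P [set w | x < T 0 w] = 0.
Proof.
move=> x0'; rewrite (_ : [set w | _] = set0) ?/prob ?measure0//.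
apply/seteqP; split => // w /= xT.
by have := T_le 0 w; rewrite big_ord0 leNgt (le_lt_trans x0' xT).
Qed.

(** The bound by the mean turns the power bound on the tail into a domination
    that is uniform in [x] and polynomial in [n]. *)
Lemma tail_sum_dominated n x : x0 <= x -> p + 1 != 0 ->
  prob P [set w | x < T n w] <= C * n%:R `^ (p + 1) * G x.
Proof.
move=> x0x p1; have x_ge0 : 0 <= x by rewrite (le_trans _ x0x)// ltW.
case: n => [|n].
  by rewrite tail_sum0// powR0// mulr0 mul0r.
apply: le_trans (tail_sum_le_mean mY mT T_le PY n.+1 x_ge0) _.
have n1 : 1 <= n.+1%:R :> R by rewrite ler1n.
apply: le_trans (ler_wpM2l (ler0n _ _) (G_power n1 x0x)) _.
rewrite powRD ?pnatr_eq0 ?implybT// powRr1//.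
by rewrite !mulrA ler_pM2r// [leRHS]mulrC mulrA.
Qed.

(** The function [a] is the amount given up by the largest term; it must be
    invisible in the tail and yet large enough to make pairs negligible. *)
Lemma tail_sum_ratio n :
  (forall (i j : 'I_n) e, i != j -> 0 < e ->
     \forall x \near +oo_R, prob P (both i j x x) <= e * G x) ->
  (forall e, 0 < e -> exists a : R -> R,
     (\forall x \near +oo_R, 0 <= a x /\ G (x - a x) <= (1 + e) * G x) /\
     forall i j : 'I_n, i != j ->
       \forall x \near +oo_R,
         prob P (both i j (x / n%:R) (a x / n%:R)) <= e * G x) ->
  prob P [set w | x < T n w] / G x @[x --> +oo_R] --> (n%:R : R).
Proof.
move=> low up; apply/cvgrPdist_le => /= e e0.
(* [n] terms and at most [n * n] pairs each contribute an error [e' * G x]. *)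
pose K : R := n%:R + n%:R * n%:R + 1.
have K0 : 0 < K by rewrite ltr_wpDl// addr_ge0// mulr_ge0.
pose e' := e / K.
have e'0 : 0 < e' by rewrite divr_gt0.
have Ke' : (n%:R + n%:R * n%:R) * e' <= e.
  by rewrite /e' mulrCA ler_piMr ?(ltW e0)// ler_pdivrMr// mul1r lerDl.
have sum_le x (f : 'I_n * 'I_n -> R) : (forall ij, ij.1 != ij.2 -> f ij <= e' * G x) ->
    \sum_(ij | ij.1 != ij.2) f ij <= n%:R * n%:R * e' * G x.
  move=> fle; rewrite big_mkcond/=.
  apply: le_trans (_ : \sum_(ij : 'I_n * 'I_n) e' * G x <= _).
    apply: ler_sum => ij _; case: ifPn => [/fle//|_].
    by rewrite mulr_ge0 ?ltW.
  by rewrite sumr_const card_prod card_ord -[_ *+ (n * n)]mulr_natl natrM mulrA.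
have [a [aG ap]] := up _ e'0.
have Flow : \forall x \near +oo_R, forall ij : 'I_n * 'I_n, ij.1 != ij.2 ->
    prob P (both ij.1 ij.2 x x) <= e' * G x.
  apply: filter_forall => -[i j] /=.
  have [->|ij] := eqVneq i j; first exact: nearW.
  by apply: filterS (low i j e' ij e'0).
have Fup : \forall x \near +oo_R, forall ij : 'I_n * 'I_n, ij.1 != ij.2 ->
    prob P (both ij.1 ij.2 (x / n%:R) (a x / n%:R)) <= e' * G x.
  apply: filter_forall => -[i j] /=.
  have [->|ij] := eqVneq i j; first exact: nearW.
  by apply: filterS (ap i j ij).
near=> x.
have Gx := G_gt0 x.
have x_ge0 : 0 <= x by near: x; exact: near_pinfty_ge.
have [ax0 Gax] : 0 <= a x /\ G (x - a x) <= (1 + e') * G x by near: x.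
have lowx : forall ij : 'I_n * 'I_n, ij.1 != ij.2 ->
    prob P (both ij.1 ij.2 x x) <= e' * G x by near: x.
have upx : forall ij : 'I_n * 'I_n, ij.1 != ij.2 ->
    prob P (both ij.1 ij.2 (x / n%:R) (a x / n%:R)) <= e' * G x by near: x.
have Hl := tail_sum_ge_pairs mY mT T_ge PY n x.
have Hu := tail_sum_le_pairs mY mT T_le PY n ax0 x_ge0.
have Sl := sum_le x _ lowx.
have Su := sum_le x _ upx.
have KG : (n%:R + n%:R * n%:R) * e' * G x <= e * G x by rewrite ler_pM2r.
have nG : n%:R * G (x - a x) <= n%:R * ((1 + e') * G x) by rewrite ler_wpM2l.
have neG : 0 <= n%:R * e' * G x.
  by apply: mulr_ge0 (ltW Gx); apply: mulr_ge0 (ltW e'0); exact: ler0n.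
rewrite distrC ler_distl; apply/andP; split.
  rewrite ler_pdivlMr// mulrBl.
  by apply: le_trans Hl; move: Sl KG neG; rewrite /both; lra.
rewrite ler_pdivrMr// mulrDl.
by apply: le_trans Hu _; move: Su KG nG; rewrite /both; lra.
Unshelve. all: by end_near. Qed.

(** With [a x = dl * x], two terms exceeding [x / n] and [dl * x / n] both exceed
    the level [dl * x / n].  Control of pairs at equal levels suffices, since
    the power bound compares the tail at this level with the tail at [x]. *)
Lemma tail_sum_ratio_rescale n :
  (forall x y, x <= y -> G y <= G x) ->
  (forall e, 0 < e -> exists2 dl, 0 < dl < 1 &
     \forall x \near +oo_R, G ((1 - dl) * x) <= (1 + e) * G x) ->
  (forall (i j : nat) e, i != j -> 0 < e ->
     \forall x \near +oo_R, prob P (both i j x x) <= e * G x) ->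
  prob P [set w | x < T n w] / G x @[x --> +oo_R] --> (n%:R : R).
Proof.
move=> G_noninc GC pair; apply: tail_sum_ratio => [i j e ij e0|e e0].
  exact: pair.
have [dl /andP[dl0 dl1] Gdl] := GC e e0.
exists (fun x => dl * x); split.
  near=> x; split.
    by rewrite mulr_ge0 ?(ltW dl0)//; near: x; exact: near_pinfty_ge.
  by rewrite (_ : x - dl * x = (1 - dl) * x); [near: x|rewrite mulrBl mul1r].
move=> i j ij.
have n0 : 0 < n%:R :> R by rewrite ltr0n (leq_ltn_trans _ (ltn_ord i)).
have n1 : 1 <= n%:R :> R by rewrite ler1n -(ltr0n R).
pose t := dl / n%:R.
have t0 : 0 < t by rewrite divr_gt0.
have tV1 : 1 <= t^-1.
  by rewrite invf_ge1// /t ler_pdivrMr// mul1r (le_trans (ltW dl1)).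
pose K := C * t^-1 `^ p.
have K0 : 0 < K by rewrite mulr_gt0// powR_gt0// invr_gt0.
have eK0 : 0 < e / K by rewrite divr_gt0.
have F := near_pinfty_scale t0 (pair i j (e / K) ij eK0).
near=> x.
have x_ge0 : 0 <= x by near: x; exact: near_pinfty_ge.
have xx0 : x0 <= x by near: x; exact: near_pinfty_ge.
have Fx : prob P (both i j (t * x) (t * x)) <= e / K * G (t * x) by near: x.
apply: le_trans (_ : prob P (both i j (t * x) (t * x)) <= _).
  apply: prob_le => //.
  have tx : t * x <= x / n%:R.
    by rewrite /t mulrAC ler_pM2r ?invr_gt0// ler_piMl// ltW.
  have dx : t * x = dl * x / n%:R by rewrite /t mulrAC.
  move=> w [/= xi xj]; split => /=; first exact: le_lt_trans xi.
  by rewrite dx.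
apply: le_trans Fx _.
have := G_power tV1 xx0; rewrite invrK [x * t]mulrC => Gt.
rewrite -(mulrA e) ler_pM2l// mulrC ler_pdivrMr//.
by rewrite [leRHS]mulrC.
Unshelve. all: by end_near. Qed.

(** A long tail does not see a constant amount [a x = L].  One of the two terms
    then exceeds only the fixed level [L / n], so pairs must be controlled at
    levels that are both large but unrelated. *)
Lemma tail_sum_ratio_shift n :
  (forall y e, 0 < y -> 0 < e ->
     \forall x \near +oo_R, G (x - y) <= (1 + e) * G x) ->
  (forall (i j : nat) e, i != j -> 0 < e ->
     exists2 M : R, 0 < M & forall x y, M <= x -> M <= y ->
       prob P (both i j x y) <= e * G x) ->
  prob P [set w | x < T n w] / G x @[x --> +oo_R] --> (n%:R : R).
Proof.
move=> GL pair; apply: tail_sum_ratio => [i j e ij e0|e e0].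
  have [M M0 MP] := pair i j e ij e0.
  by apply/near_pinftyP; exists M => // x Mx; exact: MP.
have [->|n_gt0] := posnP n.
  exists (fun=> 1); split; last by case.
  near=> x; split=> //; near: x; exact: GL.
have n0 : 0 < n%:R :> R by rewrite ltr0n.
have n1 : 1 <= n%:R :> R by rewrite ler1n.
pose K := C * n%:R `^ p.
have K0 : 0 < K by rewrite mulr_gt0// powR_gt0.
have eK0 : 0 < e / K by rewrite divr_gt0.
have : \forall M \near +oo_R, forall ij : 'I_n * 'I_n, ij.1 != ij.2 ->
    forall x y, M <= x -> M <= y -> prob P (both ij.1 ij.2 x y) <= e / K * G x.
  apply: filter_forall => -[i j] /=.
  have [->|ij] := eqVneq i j; first exact: nearW.
  have [M M0 MP] := pair i j _ ij eK0.
  apply/near_pinftyP; exists M => // M' MM' _ x y M'x M'y.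
  by apply: MP; apply: le_trans MM' _.
move=> /near_pinftyP[M M0 /(_ M (lexx _)) MP].
have L0 : 0 < M * n%:R by rewrite mulr_gt0.
exists (fun=> M * n%:R); split.
  by near=> x; split; [exact: ltW|near: x; exact: GL].
move=> i j ij; near=> x.
have xx0 : x0 <= x by near: x; exact: near_pinfty_ge.
have xM : M <= x / n%:R.
  by rewrite ler_pdivlMr//; near: x; exact: near_pinfty_ge.
rewrite mulfK ?gt_eqF//.
apply: le_trans (MP (i, j) ij _ _ xM (lexx _)) _.
apply: le_trans (ler_wpM2l (ltW eK0) (G_power n1 xx0)) _.
by rewrite mulrA divfK ?gt_eqF.
Unshelve. all: by end_near. Qed.

End FixedNumberAsymptotics.

(** * Measurability of sums of random vectors *)

Section VectorSum.
Context {R : realType} {d : nat}.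

Lemma ball_rV_nbhs (x : 'rV[R]_d) (U : set 'rV[R]_d) : open U -> U x ->
  exists2 e : R, 0 < e & forall y : 'rV[R]_d, (forall j, `|x ord0 j - y ord0 j| < e) -> U y.
Proof.
move=> oU Ux; have /nbhs_ballP[e /= e0 eU] := open_nbhs_nbhs (conj oU Ux).
exists e => // y xy; apply: eU; split=> // i j.
by rewrite ord1; exact: xy.
Qed.

Lemma ball_rVE (x y : 'rV[R]_d) (e : R) : ball x e y ->
  forall j, `|x ord0 j - y ord0 j| < e.
Proof. by move=> [_ h] j; exact: h. Qed.

Lemma rat_rV_approx (x : 'rV[R]_d) (e : R) : 0 < e ->
  exists q : 'rV[rat]_d, ball (map_mx ratr q : 'rV[R]_d) e x.
Proof.
move=> e0.
have apx (j : 'I_d) : exists q : rat, x ord0 j - e < ratr q < x ord0 j.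
  have [|q] := @rat_in_itvoo R (x ord0 j - e) (x ord0 j); first by rewrite ltrBlDr ltrDl.
  by rewrite in_itv/=; exists q.
have [q xq] := choice apx; exists (\row_j q j); split=> // i j.
rewrite ord1 !mxE /ball/= ltr_norml.
by have := xq j; lra.
Qed.

(** The Borel sigma-algebra of row vectors is not presented as a product, so the
    sum is handled through a countable base: if [f w + g w] lies in an open set,
    so does the sum of two small rational balls around [f w] and [g w]. *)
Lemma measurable_fun_addv dT (T : measurableType dT) (f g : T -> borel_rV R d) :
  measurable_fun setT f -> measurable_fun setT g ->
  measurable_fun setT (fun w => (f w : 'rV[R]_d) + (g w : 'rV[R]_d) : borel_rV R d).
Proof.
move=> mf mg; apply: (@measurability _ _ T (borel_rV R d) setT _ (@open 'rV[R]_d)) => //.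
move=> _ [U oU <-]; rewrite setTI.
pose B (q : 'rV[rat]_d) (k : nat) := ball (map_mx ratr q : 'rV[R]_d) k.+1%:R^-1.
have mB q k : measurable (B q k : set (borel_rV R d)).
  by apply: sub_sigma_algebra; exact: ball_open.
pose good (i : 'rV[rat]_d * 'rV[rat]_d * nat) :=
  forall x y, B i.1.1 i.2 x -> B i.1.2 i.2 y -> U (x + y).
have -> : (fun w => f w + g w) @^-1` U = \bigcup_i
    [set w | good i /\ (f @^-1` B i.1.1 i.2 `&` g @^-1` B i.1.2 i.2) w].
  apply/seteqP; split => [w /= Uw|w [i _ [gi [fw gw]]]]; last exact: gi.
  have [e e0 eU] := ball_rV_nbhs oU Uw.
  have [k _ /(_ _ (leqnn k)) /= ke] := near_infty_natSinv_lt (PosNum (divr_gt0 e0 (ltr0n _ 4))).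
  have k0 : 0 < k.+1%:R^-1 :> R by rewrite invr_gt0.
  have [q qf] := rat_rV_approx (f w) k0.
  have [q' qg] := rat_rV_approx (g w) k0.
  exists (q, q', k) => //; split; last by split.
  move=> x y /= xq yq; apply: eU => j; rewrite !mxE.
  have near4 (a b a' b' c c' dl : R) : dl < e / 4 -> `|c - a| < dl -> `|c - a'| < dl ->
      `|c' - b| < dl -> `|c' - b'| < dl -> `|a + b - (a' + b')| < e.
    by rewrite !ltr_norml; lra.
  have := ball_rVE qf j; have := ball_rVE xq j.
  have := ball_rVE qg j; have := ball_rVE yq j; rewrite !mxE => yj gj xj fj.
  exact: (near4 _ _ _ _ _ _ _ ke fj xj gj yj).
apply: countable_bigcupT_measurable => [|i]; first exact: countableP.
have [gi|ngi] := pselect (good i).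
  rewrite (_ : [set w | _] = f @^-1` B i.1.1 i.2 `&` g @^-1` B i.1.2 i.2).
    apply: measurableI; rewrite -[X in measurable X]setTI; [exact: mf|exact: mg].
  by apply/seteqP; split => w /=; [case|].
by rewrite (_ : [set w | _] = set0)//; apply/seteqP; split => w //= -[].
Qed.

Lemma measurable_fun_sumv dT (T : measurableType dT) (f : nat -> T -> borel_rV R d) n :
  (forall i, measurable_fun setT (f i)) ->
  measurable_fun setT (fun w => (\sum_(i < n) (f i w : 'rV[R]_d)) : borel_rV R d).
Proof.
move=> mf; elim: n => [|n IH].
  by under eq_fun do rewrite big_ord0; exact: measurable_cst.
under eq_fun do rewrite big_ord_recr/=.
exact: measurable_fun_addv.
Qed.

End VectorSum.

(** * Sums with a random number of terms *)

Section Independence.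
Context {R : realType} {dO : measure_display} {Omega : measurableType dO} {d : nat}.
Variables (P : probability Omega R) (X : nat -> {RV P >-> borel_rV R d}).

(** The measurability of finite sums is applied on [Omega] equipped with the
    sigma-algebra generated by the sequence. *)
Lemma sigma_seq_sum n (B : set (borel_rV R d)) : measurable B ->
  sigma_seq X ((fun w => (\sum_(i < n) (X i w : 'rV[R]_d)) : borel_rV R d) @^-1` B).
Proof.
move=> mB.
pose GX := [set E | exists i (B : set (borel_rV R d)),
               measurable B /\ E = X i @^-1` B].
have mX i : measurable_fun setT (X i : g_sigma_algebraType GX -> borel_rV R d).
  move=> _ C mC; rewrite setTI; apply: sub_sigma_algebra; by exists i, C.
have := measurable_fun_sumv n mX; move=> /(_ measurableT _ mB).
by rewrite setTI.
Qed.

End Independence.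

Section RandomIndex.
Context {R : realType} {dO : measure_display} {Omega : measurableType dO}.
Variables (P : probability Omega R) (N : {RV P >-> nat}).
Variable (T : nat -> Omega -> R).
Hypothesis mT : forall n x, measurable [set w | x < T n w].
Hypothesis NT : forall n x, P (N @^-1` [set n] `&` [set w | x < T n w]) =
  (P (N @^-1` [set n]) * P [set w | (x < T n w)%R])%E.

Let mN n : measurable (N @^-1` [set n]).
Proof. exact: measurable_funPTI. Qed.

Lemma random_index_event x : [set w | x < T (N w) w] =
  \bigcup_n (N @^-1` [set n] `&` [set w | x < T n w]).
Proof.
apply/seteqP; split => [w /= xT|w [n _ [/= <-//]]].
by exists (N w).
Qed.

Lemma measurable_random_index x : measurable [set w | x < T (N w) w].
Proof.
by rewrite random_index_event; apply: bigcupT_measurable => n; exact: measurableI.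
Qed.

Lemma measurable_fun_index (g : nat -> R) : measurable_fun setT (fun w => g (N w)).
Proof. by apply: measurableT_comp. Qed.

Lemma integrable_index (g : nat -> R) : (forall n, 0 <= g n) ->
  ('E_P[fun w => g (N w)] < +oo)%E -> P.-integrable setT (fun w => (g (N w))%:E).
Proof.
move=> g0; rewrite unlock => Eg; apply/integrableP; split.
  by apply/measurable_EFinP; exact: measurable_fun_index.
by under eq_integral do rewrite gee0_abs ?lee_fin//.
Qed.

Lemma expectation_index_lty (g : nat -> R) : (forall n, n%:R <= g n) ->
  ('E_P[fun w => g (N w)] < +oo)%E -> ('E_P[fun w => (N w)%:R] < +oo)%E.
Proof.
move=> ng; apply: le_lt_trans; rewrite !unlock; apply: ge0_le_integral => //.
- by apply/measurable_EFinP; exact: (measurable_fun_index (fun n => n%:R)).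
- by apply/measurable_EFinP; exact: (measurable_fun_index g).
- by move=> w _; rewrite lee_fin.
Qed.

(** Conditioning on the number of terms writes the probability as an integral
    over [N], to which dominated convergence applies. *)
Lemma prob_random_index x : (prob P [set w | x < T (N w) w])%:E =
  (\int[P]_w (prob P [set v | (x < T (N w) v)%R])%:E)%E.
Proof.
rewrite probE; last exact: measurable_random_index.
have tN : trivIset setT (fun n => N @^-1` [set n]).
  by move=> i j _ _ [w [/= <- <-]].
have UN : \bigcup_n (N @^-1` [set n]) = setT by apply/seteqP; split => // w _; exists (N w).
rewrite random_index_event measure_bigcup//; last 2 first.
- by move=> n _; exact: measurableI.
- by apply: trivIset_setIr.
rewrite -UN ge0_integral_bigcup//; last 2 first.
- apply/measurable_EFinP; apply: measurable_funTS.
  exact: (measurable_fun_index (fun n => prob P [set v | x < T n v])).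
- by move=> w _; rewrite lee_fin prob_ge0.
rewrite (@eq_eseriesl _ _ xpredT); last by move=> n; rewrite in_setT.
apply: eq_eseriesr => n _.
apply: etrans (NT n x) _; rewrite (eq_integral (fun=> (prob P [set v | x < T n v])%:E)); last first.
  by move=> w; rewrite inE/= => ->.
by rewrite integral_cst// probE// muleC.
Qed.

(** The two uses are [D] the tail itself with [c = 1], and [D] a tail that
    dominates it with [c = 0]. *)
Lemma random_index_ratio (D : R -> R) (c K q x0 : R) :
  (forall x, x0 <= x -> 0 < D x) ->
  (forall n x, x0 <= x -> prob P [set w | x < T n w] <= K * n%:R `^ q * D x) ->
  (forall n, prob P [set w | x < T n w] / D x @[x --> +oo_R] --> n%:R * c) ->
  ('E_P[fun w => ((N w)%:R `^ q)%R] < +oo)%E ->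
  (forall n, n%:R <= (n%:R : R) `^ q) ->
  prob P [set w | x < T (N w) w] / D x @[x --> +oo_R] -->
    fine 'E_P[fun w => (N w)%:R] * c.
Proof.
move=> D0 dom lim_n EN nq; apply/cvg_pinftyP => u uoo.
have EN1 := expectation_index_lty nq EN.
have EN0 : (0 <= 'E_P[fun w => (N w)%:R])%E.
  by rewrite unlock; apply: integral_ge0 => w _; rewrite lee_fin.
have ENf : ('E_P[fun w => (N w)%:R])%E \is a fin_num by rewrite ge0_fin_numE.
have [k0 _ uk0] : \forall k \near \oo, x0 <= u k.
  exact: (cvgryPge u).1.
pose a n k := prob P [set w | u (k + k0)%N < T n w] / D (u (k + k0)%N).
have Du k : 0 < D (u (k + k0)%N) by apply/D0/uk0; rewrite /= leq_addl.
rewrite -(cvg_shiftn k0).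
have -> : (fun k => prob P [set w | u (k + k0)%N < T (N w) w] / D (u (k + k0)%N)) =
    fine \o (fun k => \int[P]_w (a (N w) k)%:E)%E.
  apply/funext => k /=.
  under eq_integral do rewrite /a EFinM.
  rewrite ge0_integralZr//; last 3 first.
  - apply/measurable_EFinP.
    exact: (measurable_fun_index (fun n => prob P [set w | u (k + k0)%N < T n w])).
  - by move=> w _; rewrite lee_fin prob_ge0.
  - by rewrite lee_fin invr_ge0 ltW.
  by rewrite -prob_random_index -EFinM.
apply: fine_cvg.
rewrite EFinM fineK//.
have -> : ('E_P[fun w => (N w)%:R] * c%:E = \int[P]_w ((N w)%:R * c)%:E)%E.
  rewrite unlock; under [RHS]eq_integral do rewrite EFinM.
  rewrite integralZr//.
  by apply: (integrable_index (g := fun n => n%:R)).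
have [] // := @dominated_convergence _ _ _ P setT measurableT
  (fun k w => (a (N w) k)%:E) (fun w => ((N w)%:R * c)%:E)
  (fun w => (K * (N w)%:R `^ q)%:E).
- move=> k; apply/measurable_EFinP.
  exact: (measurable_fun_index (fun n => a n k)).
- by apply/measurable_EFinP; exact: (measurable_fun_index (fun n => n%:R * c)).
- apply: aeW => w _; apply: cvg_EFin; first exact: nearW.
  have /cvg_pinftyP/(_ u uoo) := lim_n (N w).
  by rewrite -(cvg_shiftn k0).
- under eq_fun do rewrite EFinM; apply: integrableZl => //.
  by apply: (integrable_index (g := fun n => n%:R `^ q)) => // n; exact: powR_ge0.
- apply: aeW => w k _; rewrite lee_fin ger0_norm.
    by rewrite ler_pdivrMr// dom// uk0//= leq_addl.
  by rewrite divr_ge0 ?prob_ge0// ltW.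
Qed.

End RandomIndex.

(** * Null levels *)

(** Disjoint subsets of a set of finite measure, indexed by an interval, cannot
    all have positive measure: only finitely many of them have measure at least
    [1 / k]. *)
Lemma exists_null_level (R : realType) dT (T : measurableType dT)
    (mu : {measure set T -> \bar R}) (D : R -> set T) (E : set T) (a b : R) :
  a < b -> (forall t, a < t < b -> measurable (D t)) ->
  (forall t, a < t < b -> D t `<=` E) ->
  (forall s t x, D s x -> D t x -> s = t) -> measurable E -> (mu E < +oo)%E ->
  exists2 t, a < t < b & mu (D t) = 0%E.
Proof.
move=> ab mD DE trD mE Efin; apply: contrapT => nex.
have pos t : a < t < b -> (0 < mu (D t))%E.
  move=> tab; rewrite lt_neqAle measure_ge0 andbT; apply/eqP => /esym D0.
  by apply: nex; exists t.
pose S k := [set t | a < t < b /\ (k.+1%:R^-1%:E <= mu (D t))%E].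
have Sfin k : finite_set (S k).
  apply: contrapT => /infiniteP/pcard_leP[f].
  have fS i : S k (f i) by apply: (@funS _ _ setT (S k) f).
  have finj i j : f i = f j -> i = j.
    by move=> fij; apply: (@inj _ _ setT f); rewrite ?inE.
  have mF i : measurable (D (f i)) by apply: mD; case: (fS i).
  have tF : trivIset setT (fun i => D (f i)).
    by move=> i j _ _ [x [Di Dj]]; apply: finj; exact: trD Di Dj.
  have bound n : (n%:R * k.+1%:R^-1 <= fine (mu E))%R.
    rewrite -lee_fin fineK ?ge0_fin_numE ?measure_ge0//.
    apply: (@le_trans _ _ (mu (\big[setU/set0]_(i < n) D (f i)))); last first.
      apply: le_measure; rewrite ?inE//; first exact: bigsetU_measurable.
      rewrite -(bigcup_mkord n (fun i => D (f i))) => x [i _ Dx].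
      by apply: DE Dx; case: (fS i).
    rewrite (@measure_bigsetU _ _ _ mu (fun i => D (f i)) mF tF).
    apply: (@le_trans _ _ (\sum_(i < n) k.+1%:R^-1%:E)%E).
      by rewrite sumEFin lee_fin sumr_const card_ord mulr_natl.
    by apply: lee_sum => i _; case: (fS i).
  have /archi_boundP := fine_ge0 (measure_ge0 mu E).
  set m := Num.bound _ => mlt.
  have := bound (m * k.+1)%N; rewrite natrM mulfK ?pnatr_eq0// => le.
  by have := lt_le_trans mlt le; rewrite ltxx.
have cab : countable `]a, b[%classic.
  apply: (@sub_countable _ _ _ (\bigcup_k S k)); last first.
    by apply: bigcup_countable => // k _; exact: finite_set_countable.
  apply: subset_card_le => t /=; rewrite in_itv/= => tab.
  have Dt0 := pos t tab.
  have Dtfin : mu (D t) \is a fin_num.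
    rewrite ge0_fin_numE ?measure_ge0// (le_lt_trans _ Efin)//.
    by rewrite le_measure ?inE//; [exact: mD|exact: DE].
  have f0 : 0 < fine (mu (D t)) by rewrite fine_gt0// Dt0 -ge0_fin_numE ?measure_ge0.
  have [k _ /(_ _ (leqnn k)) /= ke] := near_infty_natSinv_lt (PosNum f0).
  by exists k => //; split=> //; rewrite -[mu _]fineK// lee_fin ltW.
have := countable_lebesgue_measure0 cab.
rewrite lebesgue_measure_itv/= lte_fin ab -EFinB => -[] /eqP.
by rewrite subr_eq0 gt_eqF.
Qed.

(** * The extended orthant *)

Section ExtendedOrthant.
Context {R : realType} {d : nat}.
Local Notation Erow := 'rV[\bar R]_d.

(** A filter on the half-line either clusters at [+oo] or contains a bounded
    interval. *)
Lemma compact_ereal_ge (a : R) : compact [set x : \bar R | (a%:E <= x)%E].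
Proof.
move=> F FF Fa.
have [[U [B [FU BN UB0]]]|nex] := pselect (exists U B, [/\ F U, nbhs (+oo%E : \bar R) B &
    U `&` B = set0]); last first.
  exists +oo%E; split; first by rewrite /= leey.
  move=> U B FU BN; apply/set0P/eqP => UB0; apply: nex.
  by exists U, B.
have [M [_ MB]] := BN.
have cpt : compact (EFin @` `[a, M]%classic).
  apply: continuous_compact; last exact: segment_compact.
  by apply: continuous_subspaceT => x; apply: cvg_EFin; [exact: nearW|exact: cvg_id].
have [|x [xaM clx]] := cpt F FF.
  apply: filterS (filterI FU Fa) => -[r| |] [Ux /= ax] //.
    exists r => //; rewrite in_itv/=; move: ax; rewrite lee_fin => ->/=.
    rewrite leNgt; apply/negP => Mr.
    suff : (U `&` B) r%:E by rewrite UB0.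
    by split=> //; apply: MB; rewrite lte_fin.
  suff : (U `&` B) +oo%E by rewrite UB0.
  by split=> //; exact: nbhs_singleton.
exists x; split=> //; case: xaM => r /=; rewrite in_itv/= => /andP[ar _] <-.
by rewrite lee_fin.
Qed.

(** These sets are compact in the punctured orthant, so a Radon measure is finite
    on them, and together they cover the complement of any neighbourhood of the
    origin. *)
Definition orthant_above (j : 'I_d) (a : R) : set Erow :=
  ext_orthant `&` [set z | (a%:E <= z ord0 j)%E].

Lemma coord_ereal_continuous (j : 'I_d) : continuous (fun z : Erow => z ord0 j).
Proof.
move=> z B Bz; exists (fun i' j' => if j' == j then B else setT).
  by move=> i' j'; case: eqP => [->|_]; rewrite ?ord1//; exact: filterT.
by move=> y /(_ ord0 j); rewrite eqxx.
Qed.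

Lemma closed_coord_ge (j : 'I_d) (a : \bar R) : closed [set z : Erow | (a <= z ord0 j)%E].
Proof.
apply: (@closed_comp _ _ (fun z : Erow => z ord0 j) [set x | (a <= x)%E]).
  by move=> z _; exact: coord_ereal_continuous.
exact: closed_ereal_le_ereal.
Qed.

Lemma closed_coord_le (j : 'I_d) (a : \bar R) : closed [set z : Erow | (z ord0 j <= a)%E].
Proof.
apply: (@closed_comp _ _ (fun z : Erow => z ord0 j) [set x | (x <= a)%E]).
  by move=> z _; exact: coord_ereal_continuous.
exact: closed_ereal_ge_ereal.
Qed.

Lemma closed_ext_orthant : closed (@ext_orthant R d).
Proof.
rewrite (_ : ext_orthant = \bigcap_(j : 'I_d) [set z : Erow | (0 <= z ord0 j)%E]).
  by apply: closed_bigI => j _; exact: closed_coord_ge.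
by apply/seteqP; split => [z zo j _|z zo j]; [exact: zo|exact: (zo j I)].
Qed.

Lemma closed_orthant_above j a : closed (orthant_above j a).
Proof. by apply: closedI; [exact: closed_ext_orthant|exact: closed_coord_ge]. Qed.

Lemma compact_orthant_above j (a : R) : 0 <= a -> compact (orthant_above j a).
Proof.
move=> a0.
pose S (i : 'I_d) := [set x : \bar R | ((if i == j then a else 0)%:E <= x)%E].
have -> : orthant_above j a = [set z : Erow | forall i, S i (z ord0 i)].
  apply/seteqP; split => z /=.
    by move=> [z0 zj] i; rewrite /S/=; case: eqP => [->|_]; [exact: zj|exact: z0].
  move=> h; split => [i|].
    have := h i; rewrite /S/=; case: eqP => // _; apply: le_trans.
    by rewrite lee_fin.
  by have := h j; rewrite /S/= eqxx.
by apply: rV_compact => i; exact: compact_ereal_ge.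
Qed.

Lemma orthant_above_punctured j (a : R) : 0 < a ->
  orthant_above j a `<=` punctured_orthant.
Proof.
move=> a0 z [zo za]; split=> // z0; move: za.
by rewrite /= z0 mxE leNgt lte_fin a0.
Qed.

Lemma ext_dilate_orthant_above j (a x : R) : 0 < x ->
  ext_dilate x (orthant_above j a) = orthant_above j (x * a).
Proof.
move=> x0; apply/seteqP; split => [_ [z [zo za] <-]|z [zo za]].
  split=> [i|]; rewrite /= mxE; first by rewrite mule_ge0// lee_fin ltW.
  by rewrite EFinM lee_pmul2l// lte_fin.
have xV : 0 < x^-1 by rewrite invr_gt0.
exists (map_mx (fun t => (x^-1%:E * t)%E) z).
  split=> [i|]; rewrite /= mxE; first by rewrite mule_ge0// lee_fin ltW.
  rewrite -(@lee_pmul2l _ x%:E) ?lte_fin// muleA -!EFinM mulfV ?gt_eqF// mul1e.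
  exact: za.
by apply/matrixP => i k; rewrite !mxE muleA -EFinM mulfV ?gt_eqF// mul1e.
Qed.

Lemma embed_inj : injective (@embed R d).
Proof.
by move=> x y /rowP xy; apply/rowP => j; have := xy j; rewrite !mxE => -[].
Qed.

(** Near a finite point all points are finite, so boundaries can be computed
    among finite vectors. *)
Lemma open_embed (U : set 'rV[R]_d) : open U -> open (embed @` U).
Proof.
move=> oU; rewrite openE => _ [x Ux <-].
have [B nB BU] := open_nbhs_nbhs (conj oU Ux).
exists (fun i j => EFin @` B i j).
  move=> i j; rewrite mxE; apply/nbhs_EFin.
  by apply: filterS (nB i j) => y By; exists y.
move=> z zB; exists (map_mx fine z).
  apply: BU => i j; rewrite mxE; have [y By <-] := zB i j.
  exact: By.
apply/matrixP => i j; rewrite !mxE; have [y By <-] := zB i j.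
by [].
Qed.

Lemma measurable_embed_open (U : set 'rV[R]_d) : open U ->
  measurable (embed @` U : set (borel_rV (\bar R) d)).
Proof. by move=> oU; apply: sub_sigma_algebra; exact: open_embed. Qed.

Lemma measurable_embed_closed (C : set 'rV[R]_d) : closed C ->
  measurable (embed @` C : set (borel_rV (\bar R) d)).
Proof.
move=> cC.
have -> : embed @` C = embed @` setT `\` embed @` (~` C).
  apply/seteqP; split => [_ [x Cx <-]|_ [[x _ <-] nx]].
    by split; [exists x|move=> [y nCy /embed_inj yx]; apply: nCy; rewrite yx].
  by exists x => //; apply: contrapT => nCx; apply: nx; exists x.
apply: measurableD; apply: measurable_embed_open; first exact: openT.
exact: closed_openC.
Qed.

Lemma embed_nonneg (S : set 'rV[R]_d) :
  embed @` (S `&` nonneg_vec) = embed @` S `&` ext_orthant.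
Proof.
apply/seteqP; split => [_ [x [Sx x0] <-]|_ [[x Sx <-] xo]].
  by split; [exists x|move=> j; rewrite mxE lee_fin].
by exists x => //; split=> // j; have := xo j; rewrite mxE lee_fin.
Qed.

Lemma ext_orthant_embedP (z : Erow) : ext_orthant z ->
  (forall j, z ord0 j != +oo%E) -> exists2 x, nonneg_vec x & z = embed x.
Proof.
move=> zo zy.
have zE j : (fine (z ord0 j))%:E = z ord0 j.
  by rewrite fineK// ge0_fin_numE ?zo// ltey zy.
exists (map_mx fine z).
  by move=> j; rewrite mxE -lee_fin zE; exact: zo.
by apply/matrixP => i j; rewrite !mxE ord1 zE.
Qed.

End ExtendedOrthant.

(** * Regular variation *)

Section PowerLimits.
Context {R : realType} (V : set R -> \bar R) (alpha : R).
Hypothesis alpha_gt0 : 0 < alpha.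
Hypothesis RV : class_RV alpha V.

Lemma powRN_surj (y : R) : 0 < y -> exists2 s : R, 0 < s & s `^ (- alpha) = y.
Proof.
move=> y0; exists (y `^ (- alpha^-1)); first exact: powR_gt0.
by rewrite -powRrM mulrNN mulVf ?gt_eqF// powRr1// ltW.
Qed.

Lemma powRN_lt (s t : R) : 0 < s -> s < t -> t `^ (- alpha) < s `^ (- alpha).
Proof.
move=> s0 st; have t0 := lt_trans s0 st.
rewrite !powRN ltf_pV2 ?posrE ?powR_gt0//.
by apply: gt0_ltr_powR => //; rewrite nnegrE ltW.
Qed.

Lemma powRN_lt_inv (s t : R) : 0 < s -> 0 < t -> t `^ (- alpha) < s `^ (- alpha) -> s < t.
Proof.
move=> s0 t0 ts; rewrite ltNge; apply/negP; rewrite le_eqVlt => /predU1P[E|/(powRN_lt t0)].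
  by move: ts; rewrite E ltxx.
by move=> /lt_trans/(_ ts); rewrite ltxx.
Qed.

Lemma RV_limit_dilate (H : R -> R) (c t : R) : 0 < t ->
  H x / tail V x @[x --> +oo_R] --> c ->
  H (t * x) / tail V x @[x --> +oo_R] --> c * t `^ (- alpha).
Proof.
move=> t0 Hc; have [V0 Vt] := RV.
have L : H (t * x) / tail V (t * x) * (tail V (t * x) / tail V x) @[x --> +oo_R]
    --> c * t `^ (- alpha).
  apply: cvgM; last exact: Vt.
  exact: (@cvg_pinfty_scale _ (fun x => H x / tail V x)).
apply: cvg_trans L; apply: near_eq_cvg; near=> x.
have x0 : 0 <= x by near: x; exact: near_pinfty_ge.
have tx0 : 0 <= t * x by rewrite mulr_ge0// ltW.
by rewrite mulrA divfK// gt_eqF// V0.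
Unshelve. all: by end_near. Qed.

Lemma RV_limit_undilate (H : R -> R) (m s : R) : 0 < s ->
  H (s * x) / tail V x @[x --> +oo_R] --> m ->
  H x / tail V x @[x --> +oo_R] --> m * s `^ alpha.
Proof.
move=> s0 Hm; have sV0 : 0 < s^-1 by rewrite invr_gt0.
have := @RV_limit_dilate (fun x => H (s * x)) _ _ sV0 Hm.
have -> : s^-1 `^ (- alpha) = s `^ alpha.
  by rewrite -powR_inv1 ?(ltW s0)// -powRrM mulrNN mul1r.
by under eq_fun do rewrite mulrA mulfV ?gt_eqF// mul1r.
Qed.

(** A function whose ratio to a regularly varying tail has a positive limit
    satisfies the estimate that defines the class C. *)
Lemma RV_near_one (H : R -> R) (c : R) : 0 < c -> (forall x, 0 < H x) ->
  H x / tail V x @[x --> +oo_R] --> c ->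
  forall e, 0 < e -> exists2 dl, 0 < dl < 1 &
    \forall x \near +oo_R, H ((1 - dl) * x) <= (1 + e) * H x.
Proof.
move=> c0 H0 Hc e e0.
have y0 : 0 < 1 + e / 2 by rewrite ltr_pwDl// divr_ge0// ltW.
have [s s0 sE] := powRN_surj y0.
have s1 : s < 1.
  by apply: powRN_lt_inv => //; rewrite powR1 sE ltrDl divr_gt0.
exists (1 - s); first by rewrite subr_gt0 s1 ltrBlDr ltrDl s0.
rewrite opprB addrCA subrr addr0.
have L : H (s * x) / tail V x * (H x / tail V x)^-1 @[x --> +oo_R]
    --> c * s `^ (- alpha) * c^-1.
  by apply: cvgM; [exact: RV_limit_dilate|apply: cvgV => //; rewrite gt_eqF].
rewrite mulrAC mulfV ?gt_eqF// mul1r sE in L.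
have ye : 1 + e / 2 < 1 + e by rewrite ltrD2l ltr_pdivrMr// ltr_pMr//; lra.
have F1 : \forall x \near +oo_R, H (s * x) / tail V x * (H x / tail V x)^-1 < 1 + e.
  exact: (cvgr_lt (1 + e / 2) L).
near=> x; have [V0 _] := RV.
have x0 : 0 <= x by near: x; exact: near_pinfty_ge.
have Vx := V0 x x0.
have : H (s * x) / tail V x * (H x / tail V x)^-1 < 1 + e by near: x.
by rewrite invf_div mulrA divfK ?gt_eqF// ltr_pdivrMr// => /ltW.
Unshelve. all: by end_near. Qed.

(** [D t] plays the role of the boundary of [B t].  Convergence is known only at
    levels with a null boundary; a single such level determines the limit at all
    scales, and such levels exist in every interval. *)
Lemma RV_levels dT (T : measurableType dT) (mu : {measure set T -> \bar R})
    (B D : R -> set T) (H : R -> R) :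
  (forall t, 0 < t -> measurable (B t)) ->
  (forall t, 0 < t -> measurable (D t)) ->
  (forall s t, 0 < s -> s < t -> D t `<=` B s) ->
  (forall s t x, D s x -> D t x -> s = t) ->
  (forall t, 0 < t -> (mu (B t) < +oo)%E) ->
  (forall t, 0 < t -> mu (D t) = 0%E ->
    H (t * x) / tail V x @[x --> +oo_R] --> fine (mu (B t))) ->
  exists2 c : R, H x / tail V x @[x --> +oo_R] --> c &
    0 <= c /\ forall a b, 0 < a -> a < b ->
      exists2 t, a < t < b & mu (B t) = (c * t `^ (- alpha))%:E.
Proof.
move=> mB mD DB trD Bfin HB.
have null a b : 0 < a -> a < b -> exists2 t, a < t < b & mu (D t) = 0%E.
  move=> a0 ab; have ha0 : 0 < a / 2 by rewrite divr_gt0.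
  apply: (@exists_null_level _ _ _ mu D (B (a / 2))) => //.
  - by move=> t /andP[tab _]; apply: mD; exact: lt_trans tab.
  - by move=> t /andP[tab _]; apply: DB => //; lra.
  - exact: mB.
  - exact: Bfin.
have [s /andP[s1 s2] Ds] := null 1 2 ltr01 ltac:(lra).
have s0 : 0 < s by apply: lt_trans s1.
have Hc := RV_limit_undilate s0 (HB s s0 Ds).
exists (fine (mu (B s)) * s `^ alpha) => //; split.
  by rewrite mulr_ge0 ?fine_ge0 ?powR_ge0.
move=> a b a0 ab; have [t /andP[ta tb] Dt] := null a b a0 ab.
have t0 := lt_trans a0 ta.
exists t; first by rewrite ta.
have tfin : mu (B t) \is a fin_num by rewrite ge0_fin_numE ?measure_ge0// Bfin.
rewrite -(fineK tfin); congr (_%:E).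
exact: (cvg_unique _ (HB t t0 Dt) (RV_limit_dilate t0 Hc)).
Qed.

End PowerLimits.

Section MultivariateRegularVariation.
Context {R : realType} {d : nat}.
Variables (F : probability (borel_rV R d) R) (alpha : R) (V : probability R R)
  (mu : {measure set (borel_rV (\bar R) d) -> \bar R}).
Hypothesis alpha_gt0 : 0 < alpha.
Hypothesis FMRV : MRV F alpha V mu.

Local Notation Erow := 'rV[\bar R]_d.

Let RV : class_RV alpha V. Proof. by case: FMRV. Qed.

Lemma mu_orthant_above j (a : R) : 0 < a -> (mu (orthant_above j a) < +oo)%E.
Proof.
move=> a0; case: FMRV => _ _ [_ muK] _ _; apply: muK.
  exact: orthant_above_punctured.
by apply: compact_orthant_above; exact: ltW.
Qed.

Lemma MRV_limit (B : set Erow) (H : R -> R) :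
  measurable (B : set (borel_rV (\bar R) d)) -> B `<=` ext_orthant ->
  ~ closure B ext_zero -> mu (rel_boundary B) = 0%E -> (mu B < +oo)%E ->
  (forall x, 0 < x -> fine (F (embed @^-1` ext_dilate x B)) = H x) ->
  H x / tail V x @[x --> +oo_R] --> fine (mu B).
Proof.
move=> mB Bo B0 bB Bfin FH; case: FMRV => _ _ _ _ /(_ B mB Bo B0 bB).
have Bf : mu B \is a fin_num by rewrite ge0_fin_numE ?measure_ge0.
rewrite -(fineK Bf) => /fine_cvg; apply: cvg_trans.
apply: near_eq_cvg; near=> x.
by rewrite /= FH//; near: x; exact: near_pinfty_gt.
Unshelve. all: by end_near. Qed.

Definition infinite_coord (j : 'I_d) : set Erow :=
  ext_orthant `&` [set z | (+oo <= z ord0 j)%E].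

Lemma closed_infinite_coord j : closed (infinite_coord j).
Proof. by apply: closedI; [exact: closed_ext_orthant|exact: closed_coord_ge]. Qed.

(** The set is contained in every [orthant_above j t], whose measure is a multiple
    of [t ^ (- alpha)] for arbitrarily large [t]. *)
Lemma infinite_coord_null j : mu (infinite_coord j) = 0%E.
Proof.
pose D (t : R) : set Erow := orthant_above j t `&` [set z | (z ord0 j <= t%:E)%E].
have cD t : closed (D t).
  by apply: closedI; [exact: closed_orthant_above|exact: closed_coord_le].
pose H (x : R) : R := fine (F (embed @^-1` orthant_above j x)).
have [||||||c Hc [c0 lev]] := @RV_levels _ V alpha RV _ _ mu (orthant_above j) D H.
- by move=> t _; apply: measurable_closed_rV; exact: closed_orthant_above.
- by move=> t _; apply: measurable_closed_rV.
- move=> s t s0 st z [[zo /= tz] _]; split=> //=; apply: le_trans tz.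
  by rewrite lee_fin ltW.
- move=> s t z [[_ /= sz] /= zs] [[_ /= tz] /= zt].
  by apply/eqP; rewrite eq_le -!lee_fin (le_trans sz zt) (le_trans tz zs).
- by move=> t t0; exact: mu_orthant_above.
- move=> t t0 Dt.
  have bD : rel_boundary (orthant_above j t) `<=` D t.
    move=> z [zc zn].
    have zB : orthant_above j t z.
      by rewrite (closure_id (orthant_above j t)).1//; exact: closed_orthant_above.
    split=> //.
    have : closure [set z : Erow | (z ord0 j <= t%:E)%E] z.
      apply: closure_subset zn => y [yo /= yn] /=.
      rewrite leNgt; apply/negP => ty; apply: yn; split=> //=; exact: ltW.
    by rewrite -(closure_id _).1//; exact: closed_coord_le.
  apply: (@MRV_limit (orthant_above j t) (fun x => H (t * x))).
  + by apply: measurable_closed_rV; exact: closed_orthant_above.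
  + by move=> z [].
  + rewrite -(closure_id _).1; last exact: closed_orthant_above.
    by move=> [_ /=]; rewrite mxE leNgt lte_fin t0.
  + apply/eqP; rewrite -measure_le0 -Dt le_measure ?inE//.
      by apply: measurable_closed_rV; apply: closedI; exact: closed_closure.
    exact: measurable_closed_rV.
  + exact: mu_orthant_above.
  + by move=> x x0; rewrite ext_dilate_orthant_above// mulrC.
apply/eqP; rewrite -measure_le0; apply/lee_addgt0Pr => e e0; rewrite add0e.
have y0 : 0 < e / (c + 1) by rewrite divr_gt0// ltr_wpDl.
have [s s0 sE] := powRN_surj alpha_gt0 y0.
have [t /andP[st _] mut] := lev s (s + 1) s0 ltac:(lra).
apply: (@le_trans _ _ (mu (orthant_above j t))).
  apply: le_measure; rewrite ?inE//.
  - by apply: measurable_closed_rV; exact: closed_infinite_coord.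
  - by apply: measurable_closed_rV; exact: closed_orthant_above.
  - move=> z [zo /= zy]; split=> //=; apply: le_trans zy; exact: leey.
rewrite mut lee_fin.
apply: (@le_trans _ _ (c * (e / (c + 1)))).
  by rewrite ler_wpM2l// -sE ltW// powRN_lt.
rewrite mulrCA ler_piMr ?(ltW e0)// ler_pdivrMr ?ltr_wpDl//; lra.
Qed.

End MultivariateRegularVariation.

Section GaugeRegularVariation.
Context {R : realType} {d : nat}.
Variables (A : set 'rV[R]_d) (hA : family_R A).
Variables (F : probability (borel_rV R d) R) (alpha : R) (V : probability R R)
  (mu : {measure set (borel_rV (\bar R) d) -> \bar R}).
Hypothesis alpha_gt0 : 0 < alpha.
Hypothesis FMRV : MRV F alpha V mu.
Hypothesis F_nonneg : F (~` nonneg_vec) = 0%E.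

Local Notation Erow := 'rV[\bar R]_d.

Let above (t : R) : set Erow := embed @` ([set y | t < gauge A y] `&` nonneg_vec).
Let level (t : R) : set Erow := embed @` ([set y | gauge A y = t] `&` nonneg_vec).

Let measurable_above t : measurable (above t : set (borel_rV (\bar R) d)).
Proof.
rewrite /above embed_nonneg; apply: measurableI.
  by apply: measurable_embed_open; exact: open_gauge_gt.
by apply: measurable_closed_rV; exact: closed_ext_orthant.
Qed.

Let measurable_level t : measurable (level t : set (borel_rV (\bar R) d)).
Proof.
rewrite /level embed_nonneg; apply: measurableI; last first.
  by apply: measurable_closed_rV; exact: closed_ext_orthant.
apply: measurable_embed_closed.
apply: (@closed_comp _ _ (gauge A) [set x | x = t]).
  by move=> z _; exact: gauge_continuous.
exact: closed_eq.
Qed.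

Let level_above s t : s < t -> level t `<=` above s.
Proof. by move=> st _ [x [/= xt x0] <-]; exists x => //; split=> //=; rewrite xt. Qed.

Let level_disj s t z : level s z -> level t z -> s = t.
Proof. by move=> [x [/= <- _] <-] [y [/= <- _] /embed_inj ->]. Qed.

Let above_fin t : 0 < t -> (mu (above t) < +oo)%E.
Proof.
move=> t0; have [r r0 rA] := gauge_le_norm hA.
have rt0 : 0 < r * t by rewrite mulr_gt0.
pose K := \big[setU/set0]_(j < d) orthant_above j (r * t).
have cK : compact K.
  by apply: bigsetU_compact => j _; apply: compact_orthant_above; exact: ltW.
have KP : K `<=` punctured_orthant.
  rewrite /K; elim/big_ind: _ => [//|K1 K2 h1 h2 z [/h1//|/h2//]|j _].
  exact: orthant_above_punctured.
have mK : measurable (K : set (borel_rV (\bar R) d)).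
  apply: bigsetU_measurable => j _; apply: measurable_closed_rV.
  exact: closed_orthant_above.
apply: (@le_lt_trans _ _ (mu K)); last first.
  by case: FMRV => _ _ [_ muK] _ _; exact: muK.
apply: le_measure; rewrite ?inE//.
move=> _ [x [/= tx x0] <-].
have xn : r * t < `|x|.
  by rewrite mulrC -ltr_pdivlMr//; exact: lt_le_trans tx (rA x).
have [j xj] : exists j, r * t <= x ord0 j.
  apply: contrapT => /forallNP nx.
  suff : `|x| < r * t by rewrite ltNge ltW.
  have : ball (0 : 'rV[R]_d) (r * t) x.
    split=> // i j; rewrite ord1 /ball/= mxE sub0r normrN ger0_norm ?x0//.
    by rewrite ltNge; apply/negP.
  by rewrite -ball_normE/= sub0r normrN.
rewrite /K (bigD1 j)//=; left; split => [i|/=]; rewrite mxE lee_fin//.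
Qed.

(** On finite points the boundary of a superlevel set of the gauge is the level
    set, by continuity of the gauge; the points at infinity are negligible. *)
Let boundary_above t z : 0 < t -> rel_boundary (above t) z ->
  level t z \/ exists j, infinite_coord j z.
Proof.
move=> t0 [zc zn].
have zo : ext_orthant z.
  rewrite (closure_id ext_orthant).1; last exact: closed_ext_orthant.
  apply: closure_subset zc => _ [x [_ x0] <-] j; rewrite mxE lee_fin; exact: x0.
have [[j zj]|/forallNP zfin] := pselect (exists j, z ord0 j = +oo%E).
  by right; exists j; split=> //=; rewrite zj.
left; have [|x x0 zx] := ext_orthant_embedP zo.
  by move=> j; apply/eqP; exact: zfin.
exists x => //; split=> //=; apply/eqP; rewrite eq_le; apply/andP; split.
  rewrite leNgt; apply/negP => tx.
  have [|z' [[z'o nz'] tz']] := zn (embed @` [set y | t < gauge A y]).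
    apply: open_nbhs_nbhs; split; first by apply: open_embed; exact: open_gauge_gt.
    by rewrite zx; exists x.
  by apply: nz'; rewrite /above embed_nonneg.
rewrite leNgt; apply/negP => xt.
have [|_ [[y1 [/= ty _] <-] [y /= yt /embed_inj yE]]] := zc (embed @` [set y | gauge A y < t]).
  apply: open_nbhs_nbhs; split; last by rewrite zx; exists x.
  apply: open_embed.
  apply: (@open_comp _ _ (gauge A) [set x | x < t]); last exact: open_lt.
  by move=> u _; exact: gauge_continuous.
by move: ty; rewrite -yE ltNge ltW.
Qed.

Let boundary_above_null t : 0 < t -> mu (level t) = 0%E ->
  mu (rel_boundary (above t)) = 0%E.
Proof.
move=> t0 lev0.
pose I0 := \big[setU/set0]_(j < d) (infinite_coord j : set Erow).
have mI j : measurable (infinite_coord j : set (borel_rV (\bar R) d)).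
  by apply: measurable_closed_rV; exact: closed_infinite_coord.
have mI0 : measurable (I0 : set (borel_rV (\bar R) d)) by exact: bigsetU_measurable.
have I00 : mu I0 = 0%E.
  rewrite /I0; elim: (index_enum _) => [|j s IH]; first by rewrite big_nil measure0.
  rewrite big_cons null_set_setU//; first exact: bigsetU_measurable.
  exact: (infinite_coord_null alpha_gt0 FMRV).
apply/eqP; rewrite -measure_le0.
have <- : mu (level t `|` I0) = 0%E by rewrite null_set_setU.
apply: le_measure; rewrite ?inE.
- by apply: measurable_closed_rV; apply: closedI; exact: closed_closure.
- exact: measurableU.
move=> z /(boundary_above t0)[|[j zj]]; first by left.
by right; rewrite /I0 (bigD1 j)//=; left.
Qed.

Lemma measure_gauge_gt_nonneg x :
  F ([set y | x < gauge A y] `&` nonneg_vec) = F [set y | x < gauge A y].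
Proof.
have mn : measurable (nonneg_vec : set (borel_rV R d)).
  by apply: measurable_closed_rV; exact: closed_nonneg_vec.
have mg := measurable_gauge_gt hA x.
have F0 : F ([set y | x < gauge A y] `\` nonneg_vec) = 0%E.
  apply/eqP; rewrite -measure_le0 -F_nonneg; apply: le_measure; rewrite ?inE.
  - exact: measurableD.
  - exact: measurableC.
  - by move=> y [].
apply/esym; apply: (etrans (measureDI F mg mn)).
by rewrite [X in (X + _)%E]F0 add0e.
Qed.

Let tail_above t x : 0 < x ->
  fine (F (embed @^-1` ext_dilate x (above t))) = tail (dist_on A F) (t * x).
Proof.
move=> x0.
have -> : embed @^-1` ext_dilate x (above t) =
    [set y | t * x < gauge A y] `&` nonneg_vec.
  apply/seteqP; split => [y [_ [z [/= tz z0] <-] /matrixP yE]|y [/= ty y0]].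
    have -> : y = x *: z.
      apply/matrixP => i j; have := yE i j; rewrite !mxE -EFinM => -[].
      by rewrite ord1 => ->.
    split; first by rewrite /= gaugeZ// mulrC ltr_pM2l.
    by move=> j; rewrite mxE mulr_ge0// ltW.
  exists (embed (x^-1 *: y)).
    exists (x^-1 *: y) => //; split.
      by rewrite /= gaugeZ ?invr_gt0// ltr_pdivlMl// mulrC.
    by move=> j; rewrite mxE mulr_ge0 ?invr_ge0// ltW.
  by apply/matrixP => i j; rewrite !mxE -EFinM mulrA mulfV ?gt_eqF// mul1r.
rewrite measure_gauge_gt_nonneg /tail /dist_on /pushforward; congr (fine (F _)).
by apply/seteqP; split => y /=; rewrite in_itv/= andbT.
Qed.

(** The limit [c] exists and the superlevel sets at good levels [t] have measure
    [c * t ^ (- alpha)].  [A] is the superlevel set at level 1, which need not be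
    one of the levels found: its measure is squeezed between good levels on
    both sides. *)
Lemma MRV_tail_gauge :
  tail (dist_on A F) x / tail V x @[x --> +oo_R] --> limit_mass mu A.
Proof.
have [_ RV _ _ _] := FMRV.
have [||||||c Hc [c0 lev]] := @RV_levels _ V alpha RV _ _ mu above level (tail (dist_on A F)).
- by move=> t _; exact: measurable_above.
- by move=> t _; exact: measurable_level.
- by move=> s t _; exact: level_above.
- exact: level_disj.
- exact: above_fin.
- move=> t t0 lev0.
  apply: (MRV_limit FMRV (measurable_above t)).
  + by move=> _ [x [_ x0] <-] j; rewrite mxE lee_fin; exact: x0.
  + move=> z0.
    have z0E : ext_zero = embed (0 : 'rV[R]_d).
      by apply/matrixP => i j; rewrite !mxE.
    have [|_ [[y1 [/= ty _] <-] [y /= yt /embed_inj yE]]] :=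
        z0 (embed @` [set y | gauge A y < t]).
      apply: open_nbhs_nbhs; split; last by rewrite z0E; exists 0 => //=; rewrite gauge0.
      apply: open_embed.
      apply: (@open_comp _ _ (gauge A) [set x | x < t]); last exact: open_lt.
      by move=> u _; exact: gauge_continuous.
    by move: ty; rewrite -yE ltNge ltW.
  + exact: boundary_above_null.
  + exact: above_fin.
  + by move=> x x0; exact: tail_above.
suff -> : limit_mass mu A = c by [].
have A1 : A = [set y | 1 < gauge A y].
  rewrite -dilate_gauge//; apply/seteqP; split => y.
    by move=> Ay; exists y => //; rewrite scale1r.
  by move=> [z Az <-]; rewrite scale1r.
have -> : limit_mass mu A = fine (mu (above 1)) by rewrite /limit_mass {1}A1.
have fin t : 0 < t -> mu (above t) \is a fin_num.
  by move=> t0; rewrite ge0_fin_numE ?measure_ge0// above_fin.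
have mono s t : s <= t -> (mu (above t) <= mu (above s))%E.
  move=> st; apply: le_measure; rewrite ?inE//.
  by move=> _ [x [/= tx x0] <-]; exists x => //; split=> //=; exact: le_lt_trans tx.
have one1 : 1 `^ (- alpha) = 1 :> R by rewrite powR1.
apply/eqP; rewrite eq_le -!lee_fin fineK ?fin//; apply/andP; split.
  apply/lee_addgt0Pr => e e0.
  have y0 : 0 < 1 + e / (c + 1) by rewrite ltr_pwDl// divr_ge0 ?ltW// ltr_wpDl.
  have [s s0 sE] := powRN_surj alpha_gt0 y0.
  have s1 : s < 1.
    apply: (powRN_lt_inv alpha_gt0 s0 ltr01).
    by rewrite one1 sE ltrDl divr_gt0// ltr_wpDl.
  have [t /andP[st t1] mut] := lev s 1 s0 s1.
  apply: (le_trans (mono _ _ (ltW t1))); rewrite mut -EFinD lee_fin.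
  apply: (@le_trans _ _ (c * (1 + e / (c + 1)))).
    by rewrite ler_wpM2l// -sE ltW// powRN_lt.
  rewrite mulrDr mulr1 lerD2l mulrCA ler_piMr ?(ltW e0)// ler_pdivrMr ?ltr_wpDl//; lra.
apply/lee_addgt0Pr => e e0.
pose y := (1 + e / (c + 1))^-1.
have y1 : 1 < 1 + e / (c + 1) by rewrite ltrDl divr_gt0// ltr_wpDl.
have y0 : 0 < y by rewrite invr_gt0 (lt_trans _ y1).
have [s s0 sE] := powRN_surj alpha_gt0 y0.
have s1 : 1 < s.
  apply: (powRN_lt_inv alpha_gt0 ltr01 s0).
  by rewrite one1 sE /y invf_lt1// (lt_trans _ y1).
have [t /andP[t1 ts] mut] := lev 1 s ltr01 s1.
apply: (@le_trans _ _ (mu (above t) + e%:E)%E); last by rewrite leeD2r// mono// ltW.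
rewrite mut -EFinD lee_fin.
have : y <= t `^ (- alpha).
  by rewrite -sE ltW// powRN_lt// (lt_trans _ t1).
move=> /(ler_wpM2l c0) yt.
apply: le_trans (lerD yt (lexx e)).
have ce : c * (e / (c + 1)) <= e.
  by rewrite mulrCA ler_piMr ?(ltW e0)// ler_pdivrMr ?ltr_wpDl//; lra.
have yE : y * (1 + e / (c + 1)) = 1 by rewrite mulVf// gt_eqF// (lt_trans _ y1).
have ky : y <= 1 by rewrite invf_le1 ?ltW// (lt_trans _ y1).
have k0 : 0 <= e / (c + 1) by rewrite divr_ge0 ?ltW// ltr_wpDl.
rewrite -{1}(mulr1 c) -yE mulrDr mulr1 mulrDr lerD2l mulrCA.
by apply: le_trans ce; rewrite ler_piMl// mulr_ge0.
Qed.

End GaugeRegularVariation.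

(** * The random sum *)

Section RandomSum.
Context {R : realType} {d : nat} (A : set 'rV[R]_d) (hA : family_R A).
Context {dO : measure_display} {Omega : measurableType dO}.
Variables (P : probability Omega R) (X : nat -> {RV P >-> borel_rV R d}).
Hypothesis hX : forall i w, nonneg_vec (X i w).
Variable F : probability (borel_rV R d) R.
Hypothesis hF : common_distribution X F.
Variable N : {RV P >-> nat}.
Hypothesis hN0 : P (N @^-1` [set 0%N]) <> 1%E.
Hypothesis hNX : indep_seq N X.

Let Y i w : R := gauge A (X i w).
Let T n w : R := gauge A (\sum_(i < n) (X i w : 'rV[R]_d)).
Let FA : set R -> \bar R := dist_on A F.
Let G x : R := tail FA x.
Let EN : R := fine 'E_P[fun w => (N w)%:R].
Let PS (x : R) : R := prob P [set w | x < T (N w) w].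

Lemma tail_dist_on (Q : set (borel_rV R d) -> \bar R) (x : R) :
  tail (dist_on A Q) x = fine (Q [set y | x < gauge A y]).
Proof.
rewrite /tail /dist_on /pushforward; congr (fine (Q _)).
by apply/seteqP; split => y /=; rewrite in_itv/= andbT.
Qed.

Lemma tail_dist_on_ge0 x : 0 <= G x.
Proof. by rewrite /G tail_dist_on fine_ge0. Qed.

Lemma tail_dist_on_le1 x : G x <= 1.
Proof. by rewrite /G tail_dist_on; apply: prob_le1; exact: measurable_gauge_gt. Qed.

Lemma tail_dist_on_noninc x y : x <= y -> G y <= G x.
Proof.
move=> xy; rewrite /G !tail_dist_on; apply: prob_le.
- exact: measurable_gauge_gt.
- exact: measurable_gauge_gt.
- by move=> z /=; exact: le_lt_trans.
Qed.

Let mY i x : measurable [set w | x < Y i w].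
Proof.
have := @measurable_funPT _ _ _ _ (X i) measurableT _ (measurable_gauge_gt hA x).
by rewrite setTI.
Qed.

Let mT n x : measurable [set w | x < T n w].
Proof.
have mS := measurable_fun_sumv n (fun i => @measurable_funPT _ _ _ _ (X i)).
have := mS measurableT _ (measurable_gauge_gt hA x).
by rewrite setTI.
Qed.

Let T_le n w : T n w <= \sum_(i < n) Y i w.
Proof. exact: (gauge_sum_le hA n (fun i => X i w)). Qed.

Let T_ge n i w : (i < n)%N -> Y i w <= T n w.
Proof. by move=> ni; apply: (gauge_sum_ge hA (x := fun i => X i w)). Qed.

Let PY i x : prob P [set w | x < Y i w] = G x.
Proof.
rewrite /G tail_dist_on -(hF i)//; exact: measurable_gauge_gt.
Qed.

Let NT n x : P (N @^-1` [set n] `&` [set w | x < T n w]) =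
  (P (N @^-1` [set n]) * P [set w | (x < T n w)%R])%E.
Proof.
apply: hNX.
exact: (@sigma_seq_sum _ _ _ _ P X n _ (measurable_gauge_gt hA x)).
Qed.

Lemma common_nonneg : F (~` nonneg_vec) = 0%E.
Proof.
rewrite -(hF 0%N); last first.
  by apply: measurableC; apply: measurable_closed_rV; exact: closed_nonneg_vec.
rewrite /distribution /pushforward (_ : _ @^-1` _ = set0) ?measure0//.
by apply/seteqP; split => // w /=; apply; exact: hX.
Qed.

Lemma tail_random_sum x : tail (dist_on A (pushforward P (random_sum X N))) x = PS x.
Proof. by rewrite tail_dist_on. Qed.

Lemma prob_random_sum_dilate x : 0 < x ->
  prob P [set w | dilate x A (random_sum X N w)] = PS x.
Proof.
move=> x0; rewrite /PS; congr (prob P _); apply/seteqP.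
by split => w /= /(gauge_gtP hA _ x0).
Qed.

Lemma random_sum_noninc x y : x <= y -> PS y <= PS x.
Proof.
move=> xy; apply: prob_le.
- exact: (measurable_random_index N mT).
- exact: (measurable_random_index N mT).
- by move=> w /=; exact: le_lt_trans.
Qed.

Section Moment.
Variable p : R.
Hypothesis Jp : (upper_Matuszewska FA < p%:E)%E.
Hypothesis ENp : ('E_P[fun w => ((N w)%:R `^ (p + 1))%R] < +oo)%E.

Let p_gt0 : 0 < p.
Proof.
by have [] := Matuszewska_scale tail_dist_on_ge0 tail_dist_on_noninc Jp.
Qed.

Let G_gt0 x : 0 < G x.
Proof. exact: (Matuszewska_tail_gt0 tail_dist_on_ge0 tail_dist_on_noninc Jp). Qed.

Let nat_le_powR n : n%:R <= (n%:R : R) `^ (p + 1).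
Proof.
case: n => [|n]; first by rewrite powR_ge0.
rewrite -[leLHS]powRr1// ler_powR ?ler1n// lerDr; exact: ltW.
Qed.

Lemma expectation_gt0 : 0 < EN.
Proof.
have EN1 := expectation_index_lty nat_le_powR ENp.
rewrite /EN fine_gt0// EN1 andbT lt_neqAle; apply/andP; split; last first.
  by rewrite unlock; apply: integral_ge0 => w _; rewrite lee_fin.
apply/eqP => /esym EN0; apply: hN0.
have mN0 : measurable (N @^-1` [set 0%N]) by exact: measurable_funPTI.
suff NC0 : P (~` (N @^-1` [set 0%N])) = 0%E.
  have := probability_setC P mN0; rewrite NC0 => /esym/eqP.
  by rewrite sube_eq ?fin_num_measure// add0e => /eqP.
apply/eqP; rewrite -measure_le0 -EN0 unlock.
rewrite -[leLHS]mul1e -integral_cst; last exact: measurableC.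
rewrite integral_mkcond; apply: ge0_le_integral => //.
- by move=> w _; rewrite patchE; case: ifP.
- by apply/(measurable_restrictT _ _).1 => //; exact: measurableC.
- by apply/measurable_EFinP; exact: (measurable_fun_index N (fun n => n%:R)).
move=> w _; rewrite patchE; case: ifPn => [|_]; last by rewrite lee_fin.
by rewrite inE/= lee_fin ler1n lt0n => /eqP.
Qed.

Lemma random_sum_ratio :
  (forall n, prob P [set w | x < T n w] / G x @[x --> +oo_R] --> (n%:R : R)) ->
  PS x / G x @[x --> +oo_R] --> EN.
Proof.
move=> Tn; have [C [x0 [C0 x00 Gp]]] :=
  Matuszewska_power_bound tail_dist_on_ge0 tail_dist_on_le1 tail_dist_on_noninc Jp.
rewrite -[EN]mulr1.
apply: (random_index_ratio mT NT (K := C) (q := p + 1) (x0 := x0)) => //.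
- by move=> n x x0x; apply: (tail_sum_dominated mY mT T_le PY G_gt0 x00 Gp) => //;
    rewrite gt_eqF// addr_gt0.
- by move=> n; rewrite mulr1.
Qed.

(** If [G] is negligible with respect to [D], every [P (T_n > x) / D x] tends to
    [0] by the dominating bound, whatever the dependence of the vectors. *)
Lemma random_sum_negligible (D : R -> R) :
  (\forall x \near +oo_R, 0 < D x) ->
  G x / D x @[x --> +oo_R] --> (0 : R) ->
  PS x / D x @[x --> +oo_R] --> (0 : R).
Proof.
move=> D0 GD; have [C [x0 [C0 x00 Gp]]] :=
  Matuszewska_power_bound tail_dist_on_ge0 tail_dist_on_le1 tail_dist_on_noninc Jp.
have dom n x : x0 <= x -> prob P [set w | x < T n w] <= C * n%:R `^ (p + 1) * G x.
  move=> x0x; apply: (tail_sum_dominated mY mT T_le PY G_gt0 x00 Gp) => //.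
  by rewrite gt_eqF// addr_gt0.
have : \forall x \near +oo_R, [/\ x0 <= x, 0 < D x & G x / D x < 1].
  near=> x; split; near: x => //; first exact: near_pinfty_ge.
  exact: (cvgr_lt _ GD).
move=> /near_pinftyP[x1 x10 H1].
rewrite -(mulr0 EN).
apply: (random_index_ratio mT NT (K := C) (q := p + 1) (x0 := x1)) => //.
- by move=> x /H1[].
- move=> n x /H1[x0x Dx]; rewrite ltr_pdivrMr// mul1r => /ltW GDx.
  apply: le_trans (dom n x x0x) _; rewrite ler_wpM2l// mulr_ge0 ?powR_ge0//.
  exact: ltW.
move=> n; rewrite mulr0.
apply: (@squeeze_cvgr _ _ _ _ (fun=> 0) (fun x => C * n%:R `^ (p + 1) * (G x / D x))).
- apply/near_pinftyP; exists x1 => // x /H1[x0x Dx _].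
  rewrite divr_ge0 ?prob_ge0 ?(ltW Dx)//= mulrA ler_pM2r ?invr_gt0//.
  exact: dom.
- exact: cvg_cst.
- rewrite -[X in _ --> X](mulr0 (C * n%:R `^ (p + 1))).
  by apply: cvgM => //; exact: cvg_cst.
Unshelve. all: by end_near. Qed.

Lemma random_sum_ratio_QAI : QAI A X ->
  (forall e, 0 < e -> exists2 dl, 0 < dl < 1 &
     \forall x \near +oo_R, G ((1 - dl) * x) <= (1 + e) * G x) ->
  PS x / G x @[x --> +oo_R] --> EN.
Proof.
move=> XQ GC; apply: random_sum_ratio => n.
have [C [x0 [C0 x00 Gp]]] :=
  Matuszewska_power_bound tail_dist_on_ge0 tail_dist_on_le1 tail_dist_on_noninc Jp.
apply: (tail_sum_ratio_rescale mY mT T_le T_ge PY G_gt0 C0 Gp) => //.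
  exact: tail_dist_on_noninc.
move=> i j e ij e0.
have e2 : 0 < e / 2 by rewrite divr_gt0.
have F1 : \forall x \near +oo_R, prob P (exceeds A X i x `&` exceeds A X j x) /
    (prob P (exceeds A X i x) + prob P (exceeds A X j x)) < e / 2.
  exact: (cvgr_lt 0 (XQ i j ij)).
apply: filterS F1 => x; rewrite !PY ltr_pdivrMr ?addr_gt0// => /ltW/le_trans; apply.
by rewrite mulrDr -mulrDl -splitr.
Qed.

(** The conditioning event is the one at level [x]: the error must be compared
    with the tail at the large level [x / n], not with the tail at the constant
    level of the other term. *)
Lemma random_sum_ratio_TAI : TAI A X -> class_L FA ->
  PS x / G x @[x --> +oo_R] --> EN.
Proof.
move=> XT GL; apply: random_sum_ratio => n.
have [C [x0 [C0 x00 Gp]]] :=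
  Matuszewska_power_bound tail_dist_on_ge0 tail_dist_on_le1 tail_dist_on_noninc Jp.
apply: (tail_sum_ratio_shift mY mT T_le T_ge PY G_gt0 C0 Gp).
  by move=> y e y0 e0; exact: class_L_near.
move=> i j e ij e0.
have ji : j != i by rewrite eq_sym.
have [[U1 U2] /= [/near_pinftyP[M1 M10 H1] /near_pinftyP[M2 M20 H2]] H12] :=
  cvgr_lt 0 (XT j i ji) e e0.
exists (Num.max M1 M2); first by rewrite lt_max M10.
move=> x y; rewrite !ge_max => /andP[_ M2x] /andP[M1y _].
have := H12 (y, x) (conj (H1 _ M1y) (H2 _ M2x)).
rewrite /= /cond_prob PY ltr_pdivrMr// setIC => /ltW.
exact.
Qed.

End Moment.

End RandomSum.

Theorem theorem4p3 (R : realType) (d : nat) (hd : (0 < d)%N)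
    (A : set 'rV[R]_d) (hA : family_R A)
    (dO : measure_display) (Omega : measurableType dO)
    (P : probability Omega R)
    (X : nat -> {RV P >-> borel_rV R d})
    (hX : forall i w, nonneg_vec (X i w))
    (F : probability (borel_rV R d) R)
    (hF : common_distribution X F)
    (N : {RV P >-> nat})
    (hN0 : P (N @^-1` [set 0%N]) <> 1%E)
    (hNX : indep_seq N X) :
  let S := random_sum X N in
  let EN : R := fine 'E_P[fun w => (N w)%:R] in
  let moment := exists p : R,
    (upper_Matuszewska (dist_on A F) < p%:E)%E /\
    ('E_P[fun w => ((N w)%:R `^ (p + 1))%R] < +oo)%E in
  let P_S_in (x : R) : R := prob P [set w | dilate x A (S w)] in
  [/\ TAI A X -> class_DL (dist_on A F) -> moment ->
        asymp_equiv P_S_in (fun x => EN * fine (F (dilate x A))) /\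
        class_DL (dist_on A (pushforward P S)),
      QAI A X -> class_C (dist_on A F) -> moment ->
        asymp_equiv P_S_in (fun x => EN * fine (F (dilate x A))) /\
        class_C (dist_on A (pushforward P S)) &
      (* [mu] may vanish on [A]; then [f ~ c g] with [c = 0] can only mean
         [f / g --> 0], hence the two forms of the conclusion. *)
      forall (alpha : R) (V : probability R R)
        (mu : {measure set (borel_rV (\bar R) d) -> \bar R}),
        0 < alpha -> QAI A X -> MRV F alpha V mu -> moment ->
        (limit_mass mu A != 0 ->
           asymp_equiv P_S_in (fun x => EN * limit_mass mu A * tail V x)) /\
        (P_S_in x / tail V x @[x --> +oo_R] --> EN * limit_mass mu A)].

Proof.
move=> S EN moment P_S_in.
have G_ge0 := tail_dist_on_ge0 A F.
have G_noninc := tail_dist_on_noninc hA F.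
have PSE x : 0 < x -> P_S_in x = tail (dist_on A (pushforward P S)) x.
  by move=> x0; rewrite tail_random_sum; exact: (prob_random_sum_dilate hA).
have S_noninc x y : x <= y ->
    tail (dist_on A (pushforward P S)) y <= tail (dist_on A (pushforward P S)) x.
  by move=> xy; rewrite !tail_random_sum; exact: random_sum_noninc.
have FE x : 0 < x -> fine (F (dilate x A)) = tail (dist_on A F) x.
  by move=> x0; rewrite tail_dist_on dilate_gauge.
have equiv : 0 < EN -> tail_pos (dist_on A F) ->
    tail (dist_on A (pushforward P S)) x / tail (dist_on A F) x
      @[x --> +oo_R] --> EN ->
    asymp_equiv P_S_in (fun x => EN * fine (F (dilate x A))).
  move=> EN0 G0 SG.
  have : EN^-1 * (tail (dist_on A (pushforward P S)) x / tail (dist_on A F) x)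
      @[x --> +oo_R] --> EN^-1 * EN by apply: cvgM => //; exact: cvg_cst.
  rewrite mulVf ?gt_eqF//; apply: cvg_trans; apply: near_eq_cvg.
  apply/near_pinftyP; exists 1 => // x x1; have x0 : 0 < x by apply: lt_le_trans x1.
  by rewrite PSE// FE// invfM mulrCA.
split.
- move=> XT FDL [p [Jp ENp]].
  have EN0 : 0 < EN := expectation_gt0 hA hN0 Jp ENp.
  have SG : tail (dist_on A (pushforward P S)) x / tail (dist_on A F) x
      @[x --> +oo_R] --> EN.
    under eq_fun do rewrite tail_random_sum.
    by apply: (random_sum_ratio_TAI hA hX hF hNX Jp ENp XT); case: FDL.
  have G0 : tail_pos (dist_on A F) by case: FDL => -[].
  split; first exact: equiv.
  exact: (class_DL_equiv EN0 S_noninc G0 SG).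
- move=> XQ FC [p [Jp ENp]].
  have EN0 : 0 < EN := expectation_gt0 hA hN0 Jp ENp.
  have SG : tail (dist_on A (pushforward P S)) x / tail (dist_on A F) x
      @[x --> +oo_R] --> EN.
    under eq_fun do rewrite tail_random_sum.
    apply: (random_sum_ratio_QAI hA hX hF hNX Jp ENp XQ) => e.
    exact: class_C_near.
  have G0 : tail_pos (dist_on A F) by case: FC.
  split; first exact: equiv.
  exact: (class_C_equiv EN0 S_noninc G0 SG).
move=> alpha V mu alpha0 XQ FMRV [p [Jp ENp]].
have EN0 : 0 < EN := expectation_gt0 hA hN0 Jp ENp.
have RV : class_RV alpha V by case: FMRV.
have V0 : tail_pos V by case: RV.
have G0 := Matuszewska_tail_gt0 G_ge0 G_noninc Jp.
have GV := MRV_tail_gauge hA alpha0 FMRV (common_nonneg hX hF).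
set m := limit_mass mu A in GV *.
have nearV : \forall x \near +oo_R, 0 < tail V x.
  by apply/near_pinftyP; exists 1 => // x x1; apply: V0; apply: le_trans x1.
have PSV : P_S_in x / tail V x @[x --> +oo_R] --> EN * m.
  have [m0|m0] := eqVneq m 0.
    rewrite m0 mulr0; rewrite m0 in GV.
    have := random_sum_negligible hA hF hNX Jp ENp nearV GV.
    apply: cvg_trans; apply: near_eq_cvg.
    apply/near_pinftyP; exists 1 => // x x1; have x0 : 0 < x by apply: lt_le_trans x1.
    by rewrite PSE// tail_random_sum.
  have mgt0 : 0 < m by rewrite lt_neqAle eq_sym m0 fine_ge0.
  have SG := random_sum_ratio_QAI hA hX hF hNX Jp ENp XQ _.
  have {}SG := SG (RV_near_one alpha0 RV mgt0 G0 GV).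
  have : tail (dist_on A (pushforward P S)) x / tail (dist_on A F) x *
     (tail (dist_on A F) x / tail V x) @[x --> +oo_R] --> EN * m.
    apply: cvgM => //; under eq_fun do rewrite tail_random_sum; exact: SG.
  apply: cvg_trans; apply: near_eq_cvg.
  apply/near_pinftyP; exists 1 => // x x1; have x0 : 0 < x by apply: lt_le_trans x1.
  by rewrite PSE// mulrA divfK// gt_eqF.
split=> // m0; rewrite /asymp_equiv.
have Em0 : EN * m != 0 by rewrite mulf_neq0// gt_eqF.
have : (EN * m)^-1 * (P_S_in x / tail V x) @[x --> +oo_R] --> (EN * m)^-1 * (EN * m).
  by apply: cvgM => //; exact: cvg_cst.
rewrite mulVf//; apply: cvg_trans; apply: near_eq_cvg; apply: nearW => x.
by rewrite [in RHS]invfM mulrCA.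
Qed.
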